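(* Let $X^n=(X^n_t)_{t\ge 0}$, $n\ge 1$, be a sequence of stochastic processes with paths in $D$ that is $C$-exponentially tight. Suppose that for every $T>0$ and every $\phi\in C$ there is $J_T(\phi)\in[0,\infty]$ such that $$J_T(\phi)=-\lim_{\delta\to 0}\liminf_{n}n^{-1}\log P\Big(\sup_{t\le T}|X^n_t-\phi_t|\le\delta\Big)=-\lim_{\delta\to 0}\limsup_{n}n^{-1}\log P\Big(\sup_{t\le T}|X^n_t-\phi_t|\le\delta\Big).$$ Then the sequence $X^n$, $n\ge 1$, obeys the large deviation principle in $D$ with the rate function $$I(\phi)=\begin{cases}\sup_{T>0}J_T(\phi), & \phi\in C,\\ \infty, & \phi\in D\setminus C.\end{cases}$$
   Context: $D=D_{[0,\infty)}$ is the space of right continuous real functions on $[0,\infty)$ having left-hand limits, equipped with the Skorokhod topology (metrized by the Skorokhod–Lindvall metric, which makes it a complete separable metric space). $C\subset D$ is the subset of continuous functions. Large deviation principle: a sequence $X^n$ of processes with paths in $D$ obeys the large deviation principle in $D$ with rate function $I:D\to[0,\infty]$ if (0) for every $\alpha\ge0$ the set $\{\phi\in D: I(\phi)\le\alpha\}$ is compact; (1) for every open $G\subset D$, $\liminf_n n^{-1}\log P(X^n\in G)\ge-\inf_{\phi\in G}I(\phi)$; (2) for every closed $F\subset D$, $\limsup_n n^{-1}\log P(X^n\in F)\le-\inf_{\phi\in F}I(\phi)$. For a subsequence $X^{n'}$ the same definition is used with $n$ replaced by $n'$ (including the normalization $(n')^{-1}$). Exponential tightness: $X^n$, $n\ge1$,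 is exponentially tight if for every $c>0$ there is a compact $K_c\subset D$ with $\limsup_n n^{-1}\log P(X^n\in D\setminus K_c)\le -c$. $C$-exponential tightness: an exponentially tight sequence $X^n$, $n\ge1$, is $C$-exponentially tight if for every subsequence $X^{n'}$ which obeys the large deviation principle with some rate function $I'$, one has $I'(\phi)=\infty$ for all $\phi\in D\setminus C$. *)

(* Defs.v *)
From HB Require Import structures.
From mathcomp Require Import all_boot all_order all_algebra.
From mathcomp Require Import all_classical all_reals all_analysis.
From mathcomp Require Import lra.

Set Implicit Arguments.
Unset Strict Implicit.
Unset Printing Implicit Defensive.

Import Order.TTheory GRing.Theory Num.Theory.
Import numFieldNormedType.Exports.

Local Open Scope classical_set_scope.
Local Open Scope ring_scope.

(* A path on [0, +oo[ is encoded as a function on R that is frozen at its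
   initial value on the negative half-line, so that Leibniz equality of paths
   is equality on [0, +oo[. *)
Definition cadlag (R : realType) (x : R -> R) : Prop :=
  [/\ forall t, 0 <= t -> x s @[s --> t^'+] --> x t,
      forall t, 0 < t -> cvg (x s @[s --> t^'-])
    & forall t, t < 0 -> x t = x 0].

Record skorokhod (R : realType) : Type :=
  Skorokhod { path :> R -> R ; path_cadlag : cadlag path }.

HB.instance Definition _ (R : realType) := gen_eqMixin (skorokhod R).
HB.instance Definition _ (R : realType) := gen_choiceMixin (skorokhod R).

Definition continuous_paths (R : realType) : set (skorokhod R) :=
  [set x : skorokhod R | {within `[0, +oo[, continuous (x : R -> R)}].

(* Only the restriction of a time change to [0, +oo[ is relevant. *)
Definition timechange (R : realType) (l : R -> R) : Prop :=
  {in `[0, +oo[ &, {homo l : s t / s < t}} /\ set_bij `[0, +oo[ `[0, +oo[ l.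

Section skorokhod_lindvall.
Context {R : realType}.
Implicit Types (x y z : skorokhod R) (l : R -> R) (N : nat) (s t : R).

(* 1 on [0, N], 0 on [N + 1, +oo[, affine in between *)
Definition taper N t : R := Num.min 1 (Num.max 0 (N%:R + 1 - t)).

Local Open Scope ereal_scope.

Definition logslope l : \bar R :=
  ereal_sup [set r | exists s t, [/\ (0 <= s)%R, (s < t)%R &
    r = (`|ln ((l t - l s) / (t - s))|)%:E]].

Definition tapered_gap N x y l : \bar R :=
  ereal_sup [set (`|taper N (l t) * x (l t) - taper N t * y t|)%:E
    | t in `[0%R, +oo[ ].

Definition skdist_upto N x y : \bar R :=
  ereal_inf [set logslope l + tapered_gap N x y l | l in @timechange R].

(* The Skorokhod-Lindvall metric, in the form given by Jacod and Shiryaev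
   (Limit Theorems for Stochastic Processes, chapter VI); the series is
   dominated by a geometric one, hence finite. *)
Definition skdist x y : R :=
  fine (\sum_(1 <= N <oo) (2 ^- N)%:E * mine 1 (skdist_upto N x y)).

Lemma timechange_ge0 l t : timechange l -> (0 <= t)%R -> (0 <= l t)%R.
Proof. by case=> _ [lf _ _] t0; have := lf t; rewrite /= !in_itv /= !andbT; apply. Qed.

Lemma timechange_lt l s t : timechange l -> (0 <= s)%R -> (s < t)%R -> (l s < l t)%R.
Proof.
move=> [lm _] s0 st; by apply: lm => //; rewrite in_itv /= andbT // ltW // (le_lt_trans s0).
Qed.

Lemma timechange_slope_gt0 l s t : timechange l -> (0 <= s)%R -> (s < t)%R ->
  (0 < (l t - l s) / (t - s))%R.
Proof. by move=> lt s0 st; rewrite divr_gt0 // subr_gt0 //; exact: timechange_lt. Qed.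

Lemma timechange_id : timechange (@idfun R).
Proof.
split=> [s t _ _ //|]; split=> [t //|s t _ _ //|t t0].
by exists t.
Qed.

Lemma timechange_comp l m : timechange l -> timechange m -> timechange (l \o m).
Proof.
move=> tl tm; split.
  move=> s t; rewrite !in_itv /= !andbT => s0 t0 st.
  by apply: timechange_lt => //; [exact: timechange_ge0|exact: timechange_lt].
by case: tl tm => _ lb [_ mb]; exact: set_bij_comp mb lb.
Qed.

Lemma timechange_inv l : timechange l -> exists2 g, timechange g &
  forall t, (0 <= t)%R -> l (g t) = t /\ g (l t) = t.
Proof.
move=> tl; have [lm [lf li ls]] := tl.
have /choice[g gP] : forall u : R, exists t : R, (0 <= u)%R -> (0 <= t)%R /\ l t = u.
  move=> u; case: (leP 0%R u) => u0; last by exists 0%R.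
  have [t] : (l @` `[0%R, +oo[) u by apply: ls; rewrite /= in_itv /= andbT.
  by rewrite /= in_itv /= andbT => t0 <-; exists t.
have g0 u : (0 <= u)%R -> (0 <= g u)%R by move/gP => [].
have lg u : (0 <= u)%R -> l (g u) = u by move/gP => [].
have gl u : (0 <= u)%R -> g (l u) = u.
  move=> u0; apply: li; rewrite ?inE /= ?in_itv /= ?andbT //.
    by apply: g0; exact: timechange_ge0.
  by rewrite lg //; exact: timechange_ge0.
exists g; last by move=> t t0; rewrite lg // gl.
split.
  move=> s t; rewrite !in_itv /= !andbT => s0 t0 st.
  rewrite ltNge; apply/negP; rewrite le_eqVlt => /predU1P[e|gts].
    by move: st; rewrite -(lg s) // -(lg t) // e ltxx.
  have := timechange_lt tl (g0 _ t0) gts.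
  by rewrite !lg // ltNge (ltW st).
split.
- by move=> t; rewrite /= !in_itv /= !andbT; exact: g0.
- move=> s t; rewrite !inE /= !in_itv /= !andbT => s0 t0 e.
  by rewrite -(lg s) // e lg.
- move=> t; rewrite /= in_itv /= andbT => t0.
  exists (l t); last exact: gl.
  by rewrite /= in_itv /= andbT; exact: timechange_ge0.
Qed.

Lemma timechange0 l : timechange l -> l 0%R = 0%R.
Proof.
move=> tl; apply/eqP; rewrite eq_le (timechange_ge0 tl) // andbT.
have [g tg gP] := timechange_inv tl; have [lg _] := gP 0%R (lexx _).
case: (ltgtP 0%R (g 0%R)) (timechange_ge0 tg (lexx 0%R)) => // g0 _.
  by have := timechange_lt tl (lexx _) g0; rewrite lg => /ltW.
by move: lg; rewrite -g0 => ->.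
Qed.

Lemma logslope_ge0 l : 0 <= logslope l.
Proof.
apply: (@le_trans _ _ (`|ln ((l 1 - l 0) / (1 - 0))|)%:E).
  by rewrite lee_fin normr_ge0.
by apply: ereal_sup_ubound; exists 0%R, 1%R; split.
Qed.

Lemma logslope_ub l s t : (0 <= s)%R -> (s < t)%R ->
  (`|ln ((l t - l s) / (t - s))|)%:E <= logslope l.
Proof. by move=> s0 st; apply: ereal_sup_ubound; exists s, t. Qed.

Lemma logslope_id : logslope (@idfun R) <= 0.
Proof.
apply: ge_ereal_sup => _ [s [t [s0 st ->]]] /=.
by rewrite divff ?ln1 ?normr0 // subr_eq0 gt_eqF.
Qed.

Lemma logslope_comp l m : timechange l -> timechange m ->
  logslope (l \o m) <= logslope l + logslope m.
Proof.
move=> tl tm; apply: ge_ereal_sup => _ [s [t [s0 st ->]]] /=.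
have ms0 := timechange_ge0 tm s0.
have mst := timechange_lt tm s0 st.
apply: (le_trans _ (leeD (logslope_ub l ms0 mst) (logslope_ub m s0 st))).
rewrite -EFinD lee_fin.
have -> : ((l (m t) - l (m s)) / (t - s) =
  (l (m t) - l (m s)) / (m t - m s) * ((m t - m s) / (t - s)))%R.
  by rewrite mulrA divfK // subr_eq0 gt_eqF.
by rewrite lnM ?posrE ?timechange_slope_gt0 // ler_normD.
Qed.

Lemma logslope_inv l g : timechange l -> timechange g ->
  (forall t, (0 <= t)%R -> l (g t) = t) -> logslope g <= logslope l.
Proof.
move=> tl tg lg; apply: ge_ereal_sup => _ [s [t [s0 st ->]]] /=.
have gs0 := timechange_ge0 tg s0.
have gst := timechange_lt tg s0 st.
apply: le_trans (logslope_ub l gs0 gst).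
have t0 : (0 <= t)%R by exact: ltW (le_lt_trans s0 st).
rewrite !lg // -invf_div lnV ?posrE ?normrN //.
by rewrite divr_gt0 // subr_gt0.
Qed.

Lemma tapered_gap_ub N x y l t : (0 <= t)%R ->
  (`|taper N (l t) * x (l t) - taper N t * y t|)%:E <= tapered_gap N x y l.
Proof.
by move=> t0; apply: ereal_sup_ubound; exists t => //=; rewrite in_itv /= andbT.
Qed.

Lemma tapered_gap_ge0 N x y l : 0 <= tapered_gap N x y l.
Proof. by apply: le_trans (tapered_gap_ub N x y l (lexx _)); rewrite lee_fin. Qed.

Lemma tapered_gap_id N x : tapered_gap N x x idfun <= 0.
Proof. by apply: ge_ereal_sup => _ [t _ <-] /=; rewrite subrr normr0. Qed.

Lemma tapered_gap_comp N x y z l m : timechange m ->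
  tapered_gap N x z (l \o m) <= tapered_gap N x y l + tapered_gap N y z m.
Proof.
move=> tm; apply: ge_ereal_sup => _ [t + <-] /=; rewrite /= in_itv /= andbT => t0.
apply: (le_trans _ (leeD (tapered_gap_ub N x y l (timechange_ge0 tm t0))
  (tapered_gap_ub N y z m t0))).
by rewrite -EFinD lee_fin ler_distD.
Qed.

Lemma tapered_gap_inv N x y l g : timechange g ->
  (forall t, (0 <= t)%R -> l (g t) = t) ->
  tapered_gap N y x g <= tapered_gap N x y l.
Proof.
move=> tg lg; apply: ge_ereal_sup => _ [t + <-] /=; rewrite /= in_itv /= andbT => t0.
apply: le_trans (tapered_gap_ub N x y l (timechange_ge0 tg t0)).
by rewrite lg // distrC.
Qed.

Lemma skdist_upto_ge0 N x y : 0 <= skdist_upto N x y.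
Proof.
by apply: le_ereal_inf_tmp => _ [l _ <-]; rewrite adde_ge0 ?logslope_ge0 ?tapered_gap_ge0.
Qed.

Lemma skdist_uptoxx N x : skdist_upto N x x = 0.
Proof.
apply/eqP; rewrite eq_le skdist_upto_ge0 andbT.
have /le_trans : skdist_upto N x x <= logslope (@idfun R) + tapered_gap N x x idfun.
  by apply: ereal_inf_lbound; exists idfun => //; exact: timechange_id.
by apply; rewrite -[leRHS]adde0 leeD ?logslope_id ?tapered_gap_id.
Qed.

Lemma skdist_upto_le_sym N x y : skdist_upto N y x <= skdist_upto N x y.
Proof.
apply: le_ereal_inf_tmp => _ [l tl <-]; have [g tg gP] := timechange_inv tl.
have lg t : (0 <= t)%R -> l (g t) = t by move=> /gP[].
apply: (@le_trans _ _ (logslope g + tapered_gap N y x g)).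
  by apply: ereal_inf_lbound; exists g.
by rewrite leeD ?logslope_inv ?tapered_gap_inv.
Qed.

Lemma skdist_upto_triangle N x y z :
  skdist_upto N x z <= skdist_upto N x y + skdist_upto N y z.
Proof.
have [->|xyoo] := eqVneq (skdist_upto N x y) +oo.
  by rewrite addye ?leey // gt_eqF // (lt_le_trans _ (skdist_upto_ge0 _ _ _)) ?ltNy0.
have [->|yzoo] := eqVneq (skdist_upto N y z) +oo.
  by rewrite addey ?leey // gt_eqF // (lt_le_trans _ (skdist_upto_ge0 _ _ _)) ?ltNy0.
have fxy : skdist_upto N x y \is a fin_num by rewrite ge0_fin_numE ?skdist_upto_ge0 // ltey.
have fyz : skdist_upto N y z \is a fin_num by rewrite ge0_fin_numE ?skdist_upto_ge0 // ltey.
apply/lee_addgt0Pr => e e0.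
have e20 : (0 < e / 2)%R by rewrite divr_gt0.
have [_ [l tl <-] lxy] := lb_ereal_inf_adherent e20 fxy.
have [_ [m tm <-] myz] := lb_ereal_inf_adherent e20 fyz.
apply: (@le_trans _ _ (logslope (l \o m) + tapered_gap N x z (l \o m))).
  by apply: ereal_inf_lbound; exists (l \o m) => //; exact: timechange_comp.
apply: (le_trans (leeD (logslope_comp tl tm) (tapered_gap_comp N x y z l tm))).
rewrite addeACA (le_trans (leeD (ltW lxy) (ltW myz))) // addeACA -EFinD.
by rewrite -splitr.
Qed.

Let term N x y : \bar R := (2 ^- N)%:E * mine 1 (skdist_upto N x y).

Let term_ge0 N x y : 0 <= term N x y.
Proof.
rewrite mule_ge0 ?lee_fin ?invr_ge0 ?exprn_ge0 //.
by rewrite le_min lee01 skdist_upto_ge0.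
Qed.

Let term_le N x y : term N x y <= (2 ^- N)%:E.
Proof.
rewrite -[leRHS]mule1 lee_wpmul2l ?lee_fin ?invr_ge0 ?exprn_ge0 //.
by rewrite ge_min lexx.
Qed.

Let term_sum_fin x y : \sum_(1 <= N <oo) term N x y \is a fin_num.
Proof.
rewrite ge0_fin_numE; last by apply: nneseries_ge0 => *; exact: term_ge0.
apply: (@le_lt_trans _ _ 1); last by rewrite ltry.
apply: lime_le; first by apply: is_cvg_nneseries => *; exact: term_ge0.
apply: nearW => n; apply: (@le_trans _ _ (\sum_(1 <= N < n) (2 ^- N)%:E)).
  by apply: lee_sum => i _; exact: term_le.
rewrite sumEFin lee_fin.
suff H k : (\sum_(1 <= i < k.+1) (2 : R) ^- i = 1 - 2 ^- k)%R.
  case: n => [|n]; first by rewrite big_geq.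
  by rewrite H gerBl invr_ge0 exprn_ge0.
elim: k => [|k ih]; first by rewrite big_geq // expr0 invr1 subrr.
rewrite big_nat_recr //= ih -addrA; congr (_ + _)%R.
rewrite exprS invfM; have -> : ((2^-1 : R) = 1 - 2^-1)%R by lra.
by rewrite mulrBl mul1r; lra.
Qed.

Lemma skdistE x y : (skdist x y)%:E = \sum_(1 <= N <oo) term N x y.
Proof. by rewrite /skdist fineK //; exact: term_sum_fin. Qed.

Lemma skdistxx x : skdist x x = 0%R.
Proof.
apply: EFin_inj; rewrite skdistE; apply: eseries0 => i _ _.
by rewrite /term skdist_uptoxx min_r ?mule0.
Qed.

Lemma skdist_sym x y : skdist x y = skdist y x.
Proof.
rewrite /skdist; congr fine; congr (limn _); apply: funext => n.
apply: eq_bigr => i _; congr (_ * mine _ _).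
by apply/eqP; rewrite eq_le !skdist_upto_le_sym.
Qed.

Lemma skdist_triangle y x z : (skdist x z <= skdist x y + skdist y z)%R.
Proof.
rewrite -lee_fin EFinD !skdistE.
rewrite -nneseriesD; [|by move=> *; exact: term_ge0..].
apply: lee_nneseries => [*|N _]; first exact: term_ge0.
rewrite /term -muleDr ?ge0_adde_def ?inE ?le_min ?skdist_upto_ge0 ?lee01 //.
rewrite lee_wpmul2l ?lee_fin ?invr_ge0 ?exprn_ge0 //.
have [a0 b0] := (skdist_upto_ge0 N x y, skdist_upto_ge0 N y z).
case: (leP 1 (skdist_upto N x y)) => [xy1|xy1].
  rewrite (@le_trans _ _ 1) ?ge_min ?lexx // leeDl //.
  by rewrite le_min lee01.
case: (leP 1 (skdist_upto N y z)) => [yz1|yz1].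
  by rewrite (@le_trans _ _ 1) ?ge_min ?lexx // leeDr.
by rewrite ge_min skdist_upto_triangle orbT.
Qed.

Lemma skdist0_upto x y N : skdist x y = 0%R -> (0 < N)%N -> skdist_upto N x y = 0.
Proof.
move=> xy0 N0; have : term N x y <= 0.
  have -> : 0 = (skdist x y)%:E by rewrite xy0.
  rewrite skdistE.
  have := nneseries_lim_ge N.+1 (fun n (_ : (1 <= n)%N) (_ : xpredT n) => term_ge0 n x y).
  apply: le_trans; rewrite big_nat_recr //= leeDr //.
  by apply: sume_ge0 => *; exact: term_ge0.
rewrite /term; case: (leP 1 (skdist_upto N x y)) => H.
  by rewrite mule1 lee_fin leNgt invr_gt0 exprn_gt0.
rewrite pmule_rle0 ?lte_fin ?invr_gt0 ?exprn_gt0 // => H0.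
by apply/eqP; rewrite eq_le H0 skdist_upto_ge0.
Qed.

Lemma skorokhod_eq x y : (forall t, (0 <= t)%R -> x t = y t) -> x = y.
Proof.
move=> xy; have e : path x = path y.
  apply: funext => t; case: (leP 0%R t) => t0; first exact: xy.
  by case: x y xy => [x [? ? x0]] [y [? ? y0]] /= xy; rewrite x0 // y0 // xy.
by case: x y e {xy} => [x px] [y py] /= e; subst y; rewrite (Prop_irrelevance px py).
Qed.

Lemma skdist_positivity x y : skdist x y = 0%R -> x = y.
Proof.
move=> xy0.
have key (t e : R) : (0 <= t)%R -> (0 < e)%R ->
    exists u, [/\ (0 <= u)%R, (`|u - t| < e)%R & (`|x u - y t| < e)%R].
  move=> t0 e0.
  pose N := (Num.truncn (t + e)).+1.
  have tN : (t + e < N%:R)%R by rewrite truncnS_gt.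
  have dN := skdist0_upto xy0 (isT : (0 < N)%N).
  have [-> | tn0] := eqVneq t 0%R.
    have : skdist_upto N x y < e%:E by rewrite dN lte_fin.
    move=> /ereal_inf_lt[_ [l tl <-] le].
    have l0 := timechange0 tl.
    exists 0%R; split; rewrite ?subrr ?normr0 //.
    rewrite -lte_fin; apply: le_lt_trans le.
    apply: le_trans (leeDr _ (logslope_ge0 l)).
    have := tapered_gap_ub N x y l (lexx 0%R); rewrite l0.
    suff -> : taper N 0 = 1%R by rewrite !mul1r.
    by rewrite /taper subr0 max_r ?addr_ge0 // min_l // lerDr.
  have tp : (0 < t)%R by rewrite lt0r tn0.
  pose d := Num.min e (ln (1 + e / (t + e)))%R.
  have te0 : (0 < t + e)%R by rewrite addr_gt0.
  have ete0 : (0 < e / (t + e))%R by rewrite divr_gt0.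
  have d0 : (0 < d)%R by rewrite lt_min e0 ln_gt0 // ltrDl.
  have : skdist_upto N x y < d%:E by rewrite dN lte_fin.
  move=> /ereal_inf_lt[_ [l tl <-] ld].
  have l0 := timechange0 tl.
  have lt0 : (0 < l t)%R by have := timechange_lt tl (lexx _) tp; rewrite l0.
  have lt_t : (`|l t - t| < e)%R.
    have : (`|ln (l t / t)|)%:E < d%:E.
      apply: le_lt_trans ld; apply: le_trans (leeDl _ (tapered_gap_ge0 _ _ _ _)).
      by have := logslope_ub l (lexx _) tp; rewrite l0 !subr0.
    rewrite lte_fin lt_min => /andP[_]; rewrite ltr_norml => /andP[].
    rewrite -lnV ?posrE ?addr_gt0 //.
    have pos1 : (0 < 1 + e / (t + e))%R by rewrite addr_gt0.
    rewrite !ltr_ln ?posrE ?invr_gt0 ?divr_gt0 //.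
    rewrite ltr_pdivlMr // ltr_pdivrMr // => h1 h2.
    have h3 : (e / (t + e) * t < e)%R.
      by rewrite mulrAC ltr_pdivrMr // ltr_pM2l // ltrDl.
    have h4 : ((1 + e / (t + e))^-1 * t > t - e)%R.
      rewrite mulrC ltr_pdivlMr // mulrBl.
      have : (0 < e * (1 + e / (t + e)))%R by rewrite mulr_gt0.
      by move: h3; nra.
    rewrite ltr_norml; apply/andP; split; first by move: h1 h4; lra.
    by move: h2 h3; lra.
  exists (l t); split; [exact: ltW|exact: lt_t|].
  have tap (s : R) : (s < t + e)%R -> taper N s = 1%R.
    move=> st; rewrite /taper.
    by rewrite max_r ?min_l //; move: tN st; lra.
  have := tapered_gap_ub N x y l t0; rewrite !tap ?mul1r; last 2 first.
    by rewrite ltrDl.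
    by move: lt_t; rewrite ltr_norml => /andP[_]; lra.
  move=> gap; rewrite -lte_fin; apply: (le_lt_trans gap).
  apply: (le_lt_trans (leeDr _ (logslope_ge0 l))).
  by apply: (lt_le_trans ld); rewrite lee_fin ge_min lexx.
apply: skorokhod_eq => t t0.
have [xr _ _] := path_cadlag x; have [yr _ _] := path_cadlag y.
apply/eqP; rewrite eq_sym -subr_eq0 -normr_eq0 eq_le normr_ge0 andbT.
apply/ler_addgt0Pl => e e0; rewrite addr0.
have e30 : (0 < e / 3)%R by rewrite divr_gt0.
have near_right (f : R -> R) : f s @[s --> t^'+] --> f t ->
    exists2 d : R, (0 < d)%R & forall s, (t < s)%R -> (s < t + d)%R -> (`|f t - f s| < e / 3)%R.
  move=> /cvgrPdist_lt/(_ _ e30); rewrite near_withinE => -[d /= d0 H].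
  exists d => // s ts std; apply: H => //=.
  by rewrite distrC gtr0_norm ?subr_gt0 // ltrBlDl.
have [d1 d10 Hx] := near_right _ (xr _ t0).
have [d2 d20 Hy] := near_right _ (yr _ t0).
pose d := Num.min d1 d2.
have d0 : (0 < d)%R by rewrite lt_min d10.
have dd1 : (d <= d1)%R by rewrite ge_min lexx.
have dd2 : (d <= d2)%R by rewrite ge_min lexx orbT.
have m0 : (0 < Num.min (d / 2) (e / 3))%R by rewrite lt_min e30 divr_gt0.
have s0 : (0 <= t + d / 2)%R by rewrite addr_ge0 // ltW // divr_gt0.
have [u [u0 ut xu]] := key _ _ s0 m0.
move: ut xu; rewrite !lt_min => /andP[+ _] /andP[_ xu].
rewrite ltr_norml => /andP[ut1 ut2].
have hx : (`|x t - x u| < e / 3)%R by apply: Hx; move: ut1 ut2; lra.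
have hy : (`|y t - y (t + d / 2)| < e / 3)%R by apply: Hy; move: d0; lra.
move: hx hy xu; rewrite !ltr_norml ler_norml => /andP[? ?] /andP[? ?] /andP[? ?].
by apply/andP; split; lra.
Qed.

End skorokhod_lindvall.

HB.instance Definition _ (R : realType) := @isMetric.Build R (skorokhod R)
  skdist skdistxx skdist_positivity skdist_sym skdist_triangle.

Section large_deviations.
Context {R : realType} (d : nat -> measure_display)
  (Omega : forall n, measurableType (d n))
  (P : forall n, probability (Omega n) R)
  (X : forall n, Omega n -> skorokhod R).
Implicit Types (sigma : nat -> nat) (I : skorokhod R -> \bar R).
Local Open Scope ereal_scope.

(* n^-1 log P(E), with the convention log 0 = -oo; the junk value at n = 0
   plays no role in the limits below. *)
Definition log_prob n (E : set (Omega n)) : \bar R :=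
  (n%:R^-1)%:E * lne (P n E).

(* The large deviation principle for the sequence X (sigma 0), X (sigma 1), ... *)
Definition ldp sigma I : Prop :=
  [/\ forall phi, 0 <= I phi,
      forall a : R, (0 <= a)%R -> compact [set phi | I phi <= a%:E],
      forall G : set (skorokhod R), open G ->
        - ereal_inf (I @` G) <=
          limn_einf (fun k => log_prob (@X (sigma k) @^-1` G))
    & forall F : set (skorokhod R), closed F ->
        limn_esup (fun k => log_prob (@X (sigma k) @^-1` F)) <=
          - ereal_inf (I @` F)].

Definition exponentially_tight : Prop :=
  forall c : R, (0 < c)%R -> exists2 K : set (skorokhod R), compact K &
    limn_esup (fun n => log_prob (@X n @^-1` (~` K))) <= (- c)%:E.

Definition C_exponentially_tight : Prop :=
  exponentially_tight /\
  forall sigma I, {homo sigma : m n / (m < n)%N} -> ldp sigma I ->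
    forall phi, ~ continuous_paths phi -> I phi = +oo.

Definition unif_tube n (T : R) (phi : skorokhod R) (delta : R) :
    set (Omega n) :=
  [set w | ereal_sup [set (`|@X n w t - phi t|)%:E | t in `[0%R, T] ]
             <= delta%:E].

End large_deviations.

(* Main.v *)
Require Import Defs.
From HB Require Import structures.
From mathcomp Require Import all_boot all_order all_algebra.
From mathcomp Require Import all_classical all_reals all_analysis.
From mathcomp Require Import lra.

(** An exponentially tight sequence of laws on a separable metric space is large
    deviation relatively compact (Puhalskii): every subsequence contains a
    further one obeying a large deviation principle.  It is therefore enough to
    show that all these subsequential rate functions [I'] coincide with the
    function [I] of the theorem: if one of the two bounds failed for [X], it
    would fail by a fixed margin along some subsequence, hence also along the
    subsubsequence for which the principle with rate [I] holds
    ([ldp_of_subseq]).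

    Off [C] both functions are infinite, by C-exponential tightness.  At a
    continuous path [phi], the neighbourhoods of [phi] in the Skorokhod topology
    and in the topology of locally uniform convergence are interlaced: a small
    Skorokhod ball lies in a given uniform tube ([skball_unif_near]; this is
    where continuity of [phi] is used), and a long thin tube lies in a given
    Skorokhod ball ([unif_near_skball]).  The lower bound on open balls then
    gives [J T phi <= I' phi] for all [T], from the upper limits of the tube
    probabilities; the upper bound on closed balls, with the lower
    semicontinuity of [I'], gives [I' phi <= sup_T J T phi], from the lower
    limits.

    Puhalskii's theorem is proved as follows.  Along a suitable subsequence, each
    of the countably many logarithmic probabilities of balls with centres in a
    countable dense set and radii [1/(j+1)] has equal lower and upper limits
    ([regular_subseq]).  The rate function is then the local rate of decay of the
    probabilities of small balls ([local_rate]): the lower bound holds by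
    construction, the upper bound holds for compact sets by a covering argument,
    and for closed sets by exponential tightness ([local_rate_ldp]).

    Two facts about the path space are needed: it is separable, and a random
    path with measurable coordinates has measurable preimages of open sets.  Both
    come from one discretization.  The path is sampled on the grid of mesh
    [1/(m+1)] and the sampled values are rounded to multiples of [1/(m+1)]; the
    resulting step function ranges over a countable set, depends measurably on
    finitely many coordinates, and converges to the path in the Skorokhod metric
    ([grid_step_cvg]).  The time changes which realize this convergence are
    the identity plus a sum of tents carrying each of the finitely many large
    jump times to the next grid point ([grid_timechange]). *)

Set Implicit Arguments.
Unset Strict Implicit.
Unset Printing Implicit Defensive.

Import Order.TTheory GRing.Theory Num.Theory.
Import numFieldNormedType.Exports.

Local Open Scope classical_set_scope.
Local Open Scope ring_scope.

(** * Compactness, upper and lower limits, subsequences *)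

(** A property of sets which is local and stable under subsets and finite
    unions holds on compact sets: otherwise the complements of the sets with the
    property would generate a proper filter on [K] without cluster point.  This
    stands for the extraction of finite subcovers everywhere below. *)
Lemma compact_ind (T : topologicalType) (K : set T) (Q : set T -> Prop) :
  compact K -> Q set0 -> (forall A B, A `<=` B -> Q B -> Q A) ->
  (forall A B, Q A -> Q B -> Q (A `|` B)) ->
  (forall x, K x -> exists2 U, nbhs x U & Q U) -> Q K.
Proof.
move=> cK Q0 QS QU Qx; apply: contrapT => nQK.
pose F : set_system T := [set A | Q (K `\` A)].
have FF : ProperFilter F.
  split; first by rewrite /F /= setD0.
  split; first by rewrite /F /= setDT.
  - by move=> A B; rewrite /F /= setDIr; exact: QU.
  - move=> A B AB; apply: QS; exact: setDS.
have [|x [Kx]] := cK F FF; first by rewrite /F /= setDv.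
have [U xU QU'] := Qx _ Kx.
have FU : F (~` U) by apply: QS QU' => y [_ /contrapT].
by move=> /(_ _ _ FU xU) [y []].
Qed.

Section limsup.
Context {R : realType}.
Implicit Types (u v : nat -> \bar R) (c : \bar R) (s : nat -> nat).
Local Open Scope ereal_scope.

Lemma limn_esup_lt_near u c : limn_esup u < c -> \forall n \near \oo, u n < c.
Proof.
move=> /ereal_inf_lt[_ [V FV <-] Vc]; apply: filterS FV => n Vn.
by apply: le_lt_trans Vc; apply: ereal_sup_ubound; exists n.
Qed.

Lemma near_le_limn_esup u c : (\forall n \near \oo, u n <= c) -> limn_esup u <= c.
Proof.
move=> uc; apply: (@le_trans _ _ (ereal_sup (u @` [set n | u n <= c]))).
  by apply: ereal_inf_lbound; exists [set n | u n <= c].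
by apply: ge_ereal_sup => _ [n un <-].
Qed.

Lemma near_ge_limn_einf u c : (\forall n \near \oo, c <= u n) -> c <= limn_einf u.
Proof.
move=> uc; rewrite /limn_einf leeNr; apply: near_le_limn_esup.
by apply: filterS uc => n /=; rewrite leeN2.
Qed.

Lemma le_limn_esup u v : (\forall n \near \oo, u n <= v n) ->
  limn_esup u <= limn_esup v.
Proof.
move=> uv; apply: le_ereal_inf_tmp => _ [V FV <-].
apply: (@le_trans _ _ (ereal_sup (u @` (V `&` [set n | u n <= v n])))).
  by apply: ereal_inf_lbound; exists (V `&` [set n | u n <= v n]) => //; exact: filterI.
apply: ge_ereal_sup => _ [n [Vn un] <-]; apply: (le_trans un).
by apply: ereal_sup_ubound; exists n.
Qed.

Lemma le_limn_einf u v : (\forall n \near \oo, u n <= v n) ->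
  limn_einf u <= limn_einf v.
Proof.
move=> uv; rewrite /limn_einf leeN2; apply: le_limn_esup.
by apply: filterS uv => n; rewrite leeN2.
Qed.

Lemma cvgn_homo s : {homo s : m n / (m < n)%N} -> s @ \oo --> \oo.
Proof.
move=> hs; have hle k : (k <= s k)%N.
  by elim: k => // k /leq_ltn_trans; apply; exact: hs.
move=> A [N _ NA]; exists N => // n /= Nn; apply: NA => /=.
exact: leq_trans (hle n).
Qed.

Lemma near_subseq s (A : nat -> Prop) : {homo s : m n / (m < n)%N} ->
  (\forall n \near \oo, A n) -> \forall k \near \oo, A (s k).
Proof. by move=> hs nA; exact: (cvgn_homo hs nA). Qed.

Lemma limn_esup_sub u s : {homo s : m n / (m < n)%N} ->
  limn_esup (u \o s) <= limn_esup u.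
Proof.
move=> hs; apply: le_ereal_inf_tmp => _ [V FV <-].
apply: (@le_trans _ _ (ereal_sup ((u \o s) @` (s @^-1` V)))).
  by apply: ereal_inf_lbound; exists (s @^-1` V) => //; exact: (cvgn_homo hs).
by apply: ge_ereal_sup => _ [n Vn <-]; apply: ereal_sup_ubound; exists (s n).
Qed.

Lemma limn_einf_sub u s : {homo s : m n / (m < n)%N} ->
  limn_einf u <= limn_einf (u \o s).
Proof.
by move=> hs; rewrite /limn_einf leeN2; exact: (@limn_esup_sub (\- u)).
Qed.

End limsup.

Lemma frequently_subseq (A : set nat) : (~ \forall n \near \oo, ~ A n) ->
  exists2 s : nat -> nat, {homo s : m n / (m < n)%N} & forall k, A (s k).
Proof.
move=> nA; have /choice[f fP] : forall N : nat, exists n, (N <= n)%N /\ A n.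
  move=> N; apply: contrapT => H; apply: nA; exists N => // n /= Nn An.
  by apply: H; exists n.
pose s := fix s k := if k is k'.+1 then f (s k').+1 else f 0%N.
exists s; last by case=> [|k] /=; exact: (fP _).2.
by apply: homo_ltn => [|k /=]; [exact: ltn_trans|exact: (fP _).1].
Qed.

(** This replaces the diagonal extraction of a convergent subsequence.  A free
    ultrafilter contains each [A i] or its complement; the subsequence picks its
    [k]-th term in the first [k] of the chosen sets, whose intersection is
    infinite. *)
Lemma deciding_subseq (A : nat -> set nat) :
  exists2 s : nat -> nat, {homo s : m n / (m < n)%N} &
    forall i, (\forall k \near \oo, A i (s k)) \/ (\forall k \near \oo, ~ A i (s k)).
Proof.
have [U [UU subU]] := ultraFilterLemma (@eventually_filter : ProperFilter \oo).
have PU : ProperFilter U by exact: ultra_proper.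
have /choice[B BP] : forall i, exists B : set nat, U B /\ (B = A i \/ B = ~` A i).
  move=> i; have [UA|UA] := in_ultra_setVsetC (A i) UU.
    by exists (A i); split => //; left.
  by exists (~` A i); split => //; right.
pose C k := \bigcap_(i in `I_k) B i.
have UC k : U (C k).
  elim: k => [|k ih]; first by rewrite /C II0 bigcap_set0; exact: filterT.
  rewrite /C IIS bigcap_setU bigcap_set1; apply: filterI => //; exact: (BP k).1.
have /choice[f fP] : forall N : nat * nat, exists n, (N.1 <= n)%N /\ C N.2 n.
  move=> [N k]; have : U ([set n | (N <= n)%N] `&` C k).
    by apply: filterI => //; apply: subU; exists N.
  by move=> /filter_ex[n [? ?]]; exists n.
pose s := fix s k := if k is k'.+1 then f ((s k').+1, k'.+1) else f (0%N, 0%N).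
have sC k : C k (s k) by case: k => [|k] /=; exact: (fP (_, _)).2.
exists s.
  by apply: homo_ltn => [|k /=]; [exact: ltn_trans|exact: (fP (_, _)).1].
move=> i; have H : \forall k \near \oo, B i (s k).
  by exists i.+1 => // k /= ik; apply: (sC k).
by case: (BP i).2 H => ->; [left|right].
Qed.

Lemma lte_between_fin (R : realType) (x y : \bar R) : (x < y)%E ->
  exists r : R, (x < r%:E < y)%E.
Proof.
case: x y => [x| |] [y| |] //=; rewrite ?lte_fin => xy.
- by exists ((x + y) / 2); rewrite !lte_fin; lra.
- by exists (x + 1); rewrite lte_fin ltry; lra.
- by exists (y - 1); rewrite lte_fin ltNyr; lra.
- by exists 0; rewrite ltNyr ltry.
Qed.

(** A rational strictly between the two limits would be crossed infinitely
    often in both directions. *)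
Lemma limn_esup_le_einf (R : realType) (u : nat -> \bar R) :
  (forall a : rat, (\forall k \near \oo, (u k < (ratr a)%:E)%E) \/
                   (\forall k \near \oo, ~ (u k < (ratr a)%:E)%E)) ->
  (limn_esup u <= limn_einf u)%E.
Proof.
move=> ua; rewrite leNgt; apply/negP => /lte_between_fin[r /andP[ur /lte_between_fin[r' /andP[]]]].
rewrite lte_fin => /rat_in_itvoo[a]; rewrite in_itv /= => /andP[ra ar'] r'u.
have [ka|ka] := ua a.
- have /(lt_le_trans r'u) : (limn_esup u <= (ratr a)%:E)%E.
    by apply: near_le_limn_esup; apply: filterS ka => k /ltW.
  by rewrite lte_fin ltNge (ltW ar').
- have /le_lt_trans/(_ ur) : ((ratr a)%:E <= limn_einf u)%E.
    by apply: near_ge_limn_einf; apply: filterS ka => k /negP; rewrite -leNgt.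
  by rewrite lte_fin ltNge (ltW ra).
Qed.

(** * The Skorokhod--Lindvall metric *)

Section topo.
Context {R : realType}.
Implicit Types (x y : skorokhod R) (e : R).

Lemma skballE x e : ball x e = [set y | skdist x y < e].
Proof. by rewrite ballEmdist. Qed.

Lemma skdist_lt_split y x z e :
  skdist x y < e / 2 -> skdist y z < e / 2 -> skdist x z < e.
Proof.
move=> xy yz; have := skdist_triangle y x z.
move: (skdist x y) (skdist y z) (skdist x z) xy yz => a b c; lra.
Qed.

Lemma skball_open x e : open (ball x e : set (skorokhod R)).
Proof.
rewrite openE => y; rewrite skballE /= => xy; apply/nbhs_ballP.
exists (e - skdist x y) => /=; first by rewrite subr_gt0.
move=> z; rewrite skballE /= => yz.
by rewrite (le_lt_trans (skdist_triangle y x z)) // -ltrBrDl.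
Qed.

Lemma skcompact_closed (K : set (skorokhod R)) : compact K -> closed K.
Proof. by apply: compact_closed; exact: metric_hausdorff. Qed.

End topo.

Section skdist.
Context {R : realType}.
Implicit Types (x y : skorokhod R) (N n : nat) (t u e : R).

Lemma skdist_term_ge0 N x y : (0 <= (2 ^- N)%:E * mine 1 (skdist_upto N x y))%E.
Proof.
by rewrite mule_ge0 ?lee_fin ?invr_ge0 ?exprn_ge0 // le_min lee01 skdist_upto_ge0.
Qed.

Lemma skdist_le n x y e : 0 <= e ->
  (forall N, (N <= n)%N -> (skdist_upto N x y <= e%:E)%E) -> skdist x y <= e + 2 ^- n.
Proof.
move=> e0 xye; rewrite -lee_fin skdistE.
apply: lime_le; first by apply: is_cvg_nneseries => *; exact: skdist_term_ge0.
apply: nearW => k.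
have p0 j : 0 < (2 ^- j : R) by rewrite invr_gt0 exprn_gt0.
(* The geometric sums of [2 ^- N * e] over all levels and of [2 ^- N] over the
   levels beyond [n]. *)
suff H : (\sum_(1 <= N < k.+1) (2 ^- N)%:E * mine 1 (skdist_upto N x y) <=
    (e * (1 - 2 ^- k) + (2 ^- (minn n k) - 2 ^- k))%:E)%E.
  apply: (@le_trans _ _ (\sum_(1 <= N < k.+1) (2 ^- N)%:E * mine 1 (skdist_upto N x y))%E).
    by case: k {H} => [|k]; [rewrite !big_geq|rewrite [leRHS]big_nat_recr //= leeDl // skdist_term_ge0].
  apply: (le_trans H); rewrite lee_fin.
  have := p0 k; have [nk|kn] := leqP n k; last by have := p0 n; nra.
  by have := p0 n; nra.
elim: k => [|k ih]; first by rewrite big_geq // minn0 expr0 invr1 !subrr mulr0 addr0.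
rewrite big_nat_recr //=; apply: (le_trans (leeD2r _ ih)).
have twok : (2 ^- k = 2 * 2 ^- k.+1 :> R) by rewrite exprS invfM mulVKf.
have pk := p0 k.+1.
have [nk|kn] := leqP n k.
- have -> : minn n k.+1 = n by apply/minn_idPl; exact: leqW.
  apply: (@le_trans _ _ ((e * (1 - 2 ^- k) + (2 ^- n - 2 ^- k))%:E + (2 ^- k.+1)%:E)%E).
    rewrite leeD2l // -[leRHS]mule1 lee_wpmul2l ?lee_fin ?(ltW pk) //.
    by rewrite ge_min lexx.
  by rewrite -EFinD lee_fin twok; nra.
- have -> : minn n k.+1 = k.+1 by apply/minn_idPr.
  apply: (@le_trans _ _ ((e * (1 - 2 ^- k) + (2 ^- k - 2 ^- k))%:E + (2 ^- k.+1 * e)%:E)%E).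
    rewrite leeD2l // EFinM lee_wpmul2l ?lee_fin ?(ltW pk) //.
    by rewrite ge_min xye // orbT.
  by rewrite -EFinD lee_fin !subrr twok; nra.
Qed.

Lemma skdist_upto_lt N x y e : (0 < N)%N -> e <= 1 ->
  skdist x y < 2 ^- N * e -> (skdist_upto N x y < e%:E)%E.
Proof.
move=> N0 e1 xye.
have : ((2 ^- N)%:E * mine 1 (skdist_upto N x y) < (2 ^- N * e)%:E)%E.
  rewrite -lte_fin in xye; apply: le_lt_trans xye; rewrite skdistE.
  have := nneseries_lim_ge N.+1
    (fun n (_ : (1 <= n)%N) (_ : xpredT n) => skdist_term_ge0 n x y).
  apply: le_trans; rewrite big_nat_recr //= leeDr //.
  by apply: sume_ge0 => *; exact: skdist_term_ge0.
rewrite EFinM lte_pmul2l ?lte_fin ?invr_gt0 ?exprn_gt0 //.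
by rewrite gt_min lte_fin (ltNge 1) e1.
Qed.

Lemma taper_ge0 N t : 0 <= taper N t.
Proof. by rewrite /taper le_min ler01 le_max lexx. Qed.

Lemma taper_le1 N t : taper N t <= 1.
Proof. by rewrite /taper ge_min lexx. Qed.

Lemma taper_eq0 N t : N%:R + 1 <= t -> taper N t = 0.
Proof.
by move=> Nt; rewrite /taper max_l ?min_r //; move: Nt; lra.
Qed.

Lemma taper_eq1 N t : t <= N%:R -> taper N t = 1.
Proof.
by move=> Nt; rewrite /taper max_r ?min_l //; move: Nt; lra.
Qed.

Lemma taper_lip N t u : `|taper N t - taper N u| <= `|t - u|.
Proof.
have taperP (v : R) : [\/ v <= N%:R /\ taper N v = 1,
    (N%:R <= v <= N%:R + 1) /\ taper N v = N%:R + 1 - v |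
    N%:R + 1 <= v /\ taper N v = 0].
  have [vN|Nv] := leP v N%:R; first by constructor 1; split; rewrite ?taper_eq1.
  have [vN1|N1v] := leP (N%:R + 1) v; first by constructor 3; split; rewrite ?taper_eq0.
  constructor 2; split; first by apply/andP; split; exact: ltW.
  by rewrite /taper max_r ?min_r //; lra.
by case: (taperP t) => -[? ->]; case: (taperP u) => -[? ->];
  rewrite ler_norml; case: (ger0P (t - u)) => ?; apply/andP; split; lra.
Qed.

(** The identity is a time change without distortion. *)
Lemma skdist_upto_unif N x y e : 0 <= e ->
  (forall t, 0 <= t <= N%:R + 1 -> `|x t - y t| <= e) -> (skdist_upto N x y <= e%:E)%E.
Proof.
move=> e0 xy; apply: (@le_trans _ _ (logslope (@idfun R) + tapered_gap N x y idfun)%E).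
  by apply: ereal_inf_lbound; exists idfun => //; exact: timechange_id.
rewrite -[leRHS]add0e leeD ?logslope_id //.
apply: ge_ereal_sup => _ [t + <-]; rewrite /= in_itv /= andbT => t0.
rewrite lee_fin -mulrBr normrM ger0_norm ?taper_ge0 //.
have [tN|Nt] := leP t (N%:R + 1).
  by rewrite -[leRHS]mul1r ler_pM ?taper_ge0 ?taper_le1 // xy ?t0.
by rewrite taper_eq0 ?mul0r // ltW.
Qed.

(** The slopes of the perturbed identity lie between [1 - k] and [1 + k], and
    [1 + k <= (1 - k)^-1], so that the lower slope governs the distortion. *)
Lemma lipschitz_timechange (f : R -> R) k : k < 1 -> f 0 = 0 ->
  (forall t u, `|f t - f u| <= k * `|t - u|) ->
  timechange (fun t => t + f t) /\
  (logslope (fun t => t + f t)%R <= (- ln (1 - k))%:E)%E.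
Proof.
move=> k1 f0 fk.
have k0 : 0 <= k.
  by have := le_trans (normr_ge0 _) (fk 1 0); rewrite subr0 normr1 mulr1.
have lo t u : u < t -> (1 - k) * (t - u) <= (t + f t) - (u + f u).
  by move=> tu; have := fk t u; rewrite (gtr0_norm (_ : 0 < t - u)) ?subr_gt0 // ler_norml => /andP[]; nra.
have up t u : u < t -> (t + f t) - (u + f u) <= (1 + k) * (t - u).
  by move=> tu; have := fk t u; rewrite (gtr0_norm (_ : 0 < t - u)) ?subr_gt0 // ler_norml => /andP[]; nra.
have inc t u : u < t -> u + f u < t + f t.
  by move=> ut; have := lo _ _ ut; nra.
have ge t : 0 <= t -> (1 - k) * t <= t + f t.
  by rewrite le_eqVlt => /predU1P[<-|/lo]; rewrite ?f0 ?mulr0 ?addr0 // !subr0.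
have cf : continuous f.
  move=> t; apply/cvgrPdist_le => e e0; near=> u.
  apply: (le_trans (fk _ _)).
  apply: (@le_trans _ _ `|t - u|); first by rewrite ler_piMl // ltW.
  by near: u; apply: cvgr_dist_le.
split.
  split; first by move=> s t _ _; exact: inc.
  split.
  - move=> t; rewrite /= !in_itv /= !andbT => t0; apply: le_trans (ge _ t0); nra.
  - move=> t u _ _ tu; case: (ltgtP t u) => // /inc; by rewrite tu ltxx.
  - move=> y; rewrite /= in_itv /= andbT => y0.
    have b0 : 0 <= y / (1 - k) by rewrite divr_ge0 // subr_ge0 ltW.
    have [||c] := @IVT R (fun t => t + f t) 0 (y / (1 - k)) y b0.
    + by apply: continuous_subspaceT => t; apply: cvgD => //; exact: cf.
    + rewrite f0 addr0 le_max ge_min y0 /=; apply/orP; right.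
      by apply: le_trans (ge _ b0); rewrite mulrC divfK // subr_eq0 gt_eqF.
    by rewrite in_itv /= => /andP[c0 _] <-; exists c => //; rewrite /= in_itv /= c0.
apply: ge_ereal_sup => _ [s [t [s0 st ->]]]; rewrite lee_fin.
have ts : 0 < t - s by rewrite subr_gt0.
have [l1 l2] := (lo _ _ st, up _ _ st).
have q1 : 1 - k <= (t + f t - (s + f s)) / (t - s) by rewrite ler_pdivlMr.
have q2 : (t + f t - (s + f s)) / (t - s) <= 1 + k by rewrite ler_pdivrMr.
have kp : 0 < 1 - k by rewrite subr_gt0.
have qp := lt_le_trans kp q1.
rewrite ler_norml opprK ler_ln ?posrE // q1 /= -lnV ?posrE // ler_ln ?posrE ?invr_gt0 //.
apply: (le_trans q2); rewrite -[leRHS]mul1r ler_pdivlMr //; nra.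
Unshelve. all: by end_near. Qed.

End skdist.

(** * Discretization of cadlag paths *)

Section approx.
Context {R : realType}.
Implicit Types (x y : skorokhod R) (m n : nat) (t u v e : R) (s : seq R).

Lemma cadlag_right_osc x t e : 0 <= t -> 0 < e -> exists2 d : R, 0 < d &
  forall u v, t <= u < t + d -> t <= v < t + d -> `|x u - x v| <= e.
Proof.
move=> t0 e0; have [xr _ _] := path_cadlag x.
have e20 : 0 < e / 2 by rewrite divr_gt0.
have /cvgrPdist_le/(_ _ e20) := xr _ t0; rewrite near_withinE => -[d /= d0 H].
have H' u : t <= u < t + d -> `|x t - x u| <= e / 2.
  move=> /andP[]; rewrite le_eqVlt => /predU1P[<- _|tu ud]; first by rewrite subrr normr0 ltW.
  by apply: H => //=; rewrite distrC gtr0_norm ?subr_gt0 // ltrBlDl.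
exists d => // u v /H' + /H'; rewrite !ler_norml => /andP[? ?] /andP[? ?].
by apply/andP; split; lra.
Qed.

Lemma cadlag_left_osc x t e : 0 <= t -> 0 < e -> exists2 d : R, 0 < d &
  forall u v, 0 <= u -> 0 <= v -> t - d <= u < t -> t - d <= v < t -> `|x u - x v| <= e.
Proof.
rewrite le_eqVlt => /predU1P[<- _|t0 e0].
  by exists 1 => // u v u0 _ /andP[_]; rewrite ltNge u0.
have [_ xl _] := path_cadlag x.
have e20 : 0 < e / 2 by rewrite divr_gt0.
have /cvg_ex[l] := xl _ t0.
move=> /cvgrPdist_le/(_ _ e20); rewrite near_withinE => -[d /= d0 H].
have H' u : t - d / 2 <= u < t -> `|l - x u| <= e / 2.
  move=> /andP[tu ut]; apply: H => //=; rewrite gtr0_norm ?subr_gt0 //.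
  by move: d0 tu; lra.
exists (d / 2); first by rewrite divr_gt0.
move=> u v _ _ /H' + /H'; rewrite !ler_norml => /andP[? ?] /andP[? ?].
by apply/andP; split; lra.
Qed.

(** Cadlag paths have small oscillation on the cells of a finite partition of
    [[0, M]].  The partition is given by an unordered sequence of cut points: two
    times are in the same cell when every cut point is on the same side of both.
    No ordering of the cut points is then ever needed. *)
Lemma cadlag_cells x (M e : R) : 0 < e -> exists s, forall u v, 0 <= u -> 0 <= v <= M ->
  {in s, forall p, (p <= u) = (p <= v)} -> `|x u - x v| <= e.
Proof.
move=> e0.
pose Q (A : set R) := exists s, forall u v, 0 <= u -> 0 <= v -> A v ->
  {in s, forall p, (p <= u) = (p <= v)} -> `|x u - x v| <= e.
suff [s sP] : Q `[0, M]%classic.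
  exists s => u v u0 /andP[v0 vM] puv; apply: sP => //=.
  by rewrite in_itv /= v0.
apply: compact_ind; first exact: segment_compact.
- by exists [::].
- by move=> A B AB [s sP]; exists s => u v u0 v0 /AB; exact: sP.
- move=> A B [s sP] [s' sP']; exists (s ++ s') => u v u0 v0 [Av|Bv] H.
  + by apply: sP => // p ps; apply: H; rewrite mem_cat ps.
  + by apply: sP' => // p ps; apply: H; rewrite mem_cat ps orbT.
- move=> t; rewrite /= in_itv /= => /andP[t0 tM].
  have [d1 d10 H1] := cadlag_right_osc x t0 e0.
  have [d2 d20 H2] := cadlag_left_osc x t0 e0.
  pose d := Num.min d1 d2.
  have d0 : 0 < d by rewrite lt_min d10.
  have dd1 : d <= d1 by rewrite ge_min lexx.
  have dd2 : d <= d2 by rewrite ge_min lexx orbT.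
  exists (ball t d); first exact: nbhsx_ballx.
  exists [:: t - d; t; t + d] => u v u0 v0; rewrite /ball /= ltr_norml => /andP[tv1 tv2] H.
  have h1 : t - d <= u by rewrite H ?inE ?eqxx //; move: tv2; lra.
  have h2 : u < t + d by rewrite ltNge H ?inE ?eqxx ?orbT // -ltNge; move: tv1; lra.
  have := H t; rewrite !inE eqxx orbT => /(_ isT); case: (leP t v) => tv.
  + by move=> tu; apply: H1; apply/andP; split; move: tv1; lra.
  + by move=> /negbT; rewrite -ltNge => ut; apply: H2 => //; apply/andP; split; move: tv2; lra.
Qed.

Lemma cadlag_bounded x (M : R) : exists2 B : R, 0 <= B & forall t, 0 <= t <= M -> `|x t| <= B.
Proof.
pose Q (A : set R) := exists2 B : R, 0 <= B & forall t, A t -> 0 <= t -> `|x t| <= B.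
suff [B B0 BP] : Q `[0, M]%classic.
  by exists B => // t /andP[t0 tM]; apply: BP => //=; rewrite in_itv /= t0.
apply: compact_ind; first exact: segment_compact.
- by exists 0.
- by move=> A B AB [b b0 bP]; exists b => // t /AB; exact: bP.
- move=> A B [a a0 aP] [b b0 bP]; exists (Num.max a b); first by rewrite le_max a0.
  by move=> t [/aP|/bP] H /H h; rewrite le_max h ?orbT.
move=> t; rewrite /= in_itv /= => /andP[t0 tM].
have [d1 d10 H1] := cadlag_right_osc x t0 ltr01.
have [d2 d20 H2] := cadlag_left_osc x t0 ltr01.
pose w := Num.max 0 (t - d2 / 2).
exists (ball t (Num.min d1 (d2 / 2))).
  by apply: nbhsx_ballx; rewrite lt_min d10 divr_gt0.
exists (`|x t| + `|x w| + 1).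
  by rewrite !addr_ge0.
move=> u; rewrite /ball /= ltr_norml lt_min ltrNl lt_min => /andP[/andP[u1 u2] /andP[u3 u4]] u0.
have tri a : `|x u - x a| <= 1 -> `|x u| <= `|x a| + 1.
  by move=> ua; rewrite -[x u](subrK (x a)) addrC (le_trans (ler_normD _ _)) // lerD2l.
have [tu|ut] := leP t u.
  have : `|x u - x t| <= 1 by apply: H1; apply/andP; split => //; lra.
  by move=> /tri; have := normr_ge0 (x w); lra.
have : `|x u - x w| <= 1.
  apply: H2 => //; first by rewrite /w le_max lexx.
    by apply/andP; split => //; lra.
  rewrite /w le_max gt_max; apply/andP; split; last by apply/andP; split; lra.
  by apply/orP; right; lra.
by move=> /tri; have := normr_ge0 (x t); lra.
Qed.

Lemma seq_pos_lower_bound s : {in s, forall r, 0 < r} -> exists2 e : R, 0 < e & {in s, forall r, e <= r}.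
Proof.
elim: s => [|r s ih] H; first by exists 1.
have [|e e0 es] := ih; first by move=> p ps; apply: H; rewrite inE ps orbT.
exists (Num.min e r); first by rewrite lt_min e0 H // inE eqxx.
move=> p; rewrite inE => /predU1P[->|/es ep]; first by rewrite ge_min lexx orbT.
by rewrite ge_min ep.
Qed.

Lemma nat_ceil (r : R) : 0 <= r -> exists a : nat,
  [/\ forall j : nat, (r <= j%:R) = (a <= j)%N, r <= a%:R & a%:R <= r + 1].
Proof.
move=> r0; have /andP[h1 h2] := real_ceil_itv (num_real r).
have c0 : 0 <= Num.ceil r.
  by rewrite real_ceil_ge0 ?num_real // (lt_le_trans _ r0).
have [a ac] : exists a : nat, Num.ceil r = a%:Z by case: (Num.ceil r) c0 => // a _; exists a.
move: h1 h2; rewrite ac intrB /= -!pmulrn => h1 h2; exists a; split => //.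
  by move=> j; rewrite -lez_nat -ac real_ceil_le_int ?num_real // -pmulrn.
by move: h1; rewrite ltrBlDr => /ltW.
Qed.

Definition tent (rho p t : R) := Num.max 0 (1 - `|t - p| / rho).

Lemma tent_lip (rho p t u : R) : 0 < rho -> `|tent rho p t - tent rho p u| <= `|t - u| / rho.
Proof.
move=> rho0; rewrite /tent.
have maxlip (a b : R) : `|Num.max 0 a - Num.max 0 b| <= `|a - b|.
  case: (leP 0 a) => ?; case: (leP 0 b) => ?; rewrite ler_norml; case: (ger0P (a - b)) => ?; apply/andP; split; lra.
apply: (le_trans (maxlip _ _)).
rewrite (_ : _ - _ = (`|u - p| - `|t - p|) / rho); last by rewrite mulrBl; lra.
rewrite normrM (gtr0_norm (x := rho^-1)) ?invr_gt0 // ler_pM2r ?invr_gt0 //.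
apply: (le_trans (ler_dist_dist _ _)).
by rewrite opprB addrA subrK distrC.
Qed.

Lemma tent_itv (rho p t : R) : 0 < rho -> 0 <= tent rho p t <= 1.
Proof.
move=> rho0; rewrite /tent le_max lexx /= ge_max ler01 /=.
by rewrite gerBl divr_ge0 // ltW.
Qed.

Lemma tent_out (rho p t : R) : 0 < rho -> rho <= `|t - p| -> tent rho p t = 0.
Proof. by move=> rho0 h; rewrite /tent max_l // subr_le0 ler_pdivlMr // mul1r. Qed.

Lemma tent_center (rho p : R) : tent rho p p = 1.
Proof. by rewrite /tent subrr normr0 mul0r subr0 max_r. Qed.

Definition gridfloor m t : R := (Num.truncn (m.+1%:R * t))%:R / m.+1%:R.

Lemma ex_invn_lt (e : R) : 0 < e -> exists M, forall m, (M <= m)%N -> m.+1%:R^-1 < e.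
Proof.
move=> e0; exists (Num.truncn e^-1) => m Mm; rewrite -[ltRHS]invrK ltf_pV2 ?posrE ?invr_gt0 //.
by rewrite (lt_le_trans (truncnS_gt _)) // ler_nat.
Qed.

(** The time change moves each cut point [p] of [s] to the next grid point
    [a / (m+1)], so that a grid point is at least [p] if and only if it is at
    least the image of [p].  It is the identity plus one tent per cut point; tents of
    half-width at most the gaps between cut points do not interfere at the cut
    points, and the sum has Lipschitz constant at most
    [size s / ((m+1) * rho)], which tends to 0. *)
Lemma grid_timechange s (k delta : R) : 0 < k < 1 -> 0 < delta -> {in s, forall p, 0 < p} ->
  exists M, forall m, (M <= m)%N -> exists l, [/\ timechange l,
    (logslope l <= (- ln (1 - k))%:E)%E,
    forall t, `|l t - t| <= delta &
    forall t p, 0 <= t -> p \in s -> (p <= gridfloor m (l t)) = (p <= t)].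
Proof.
move=> /andP[k0 k1] delta0 s0; pose s' := undup s.
have [rho rho0 rhoP] : exists2 rho : R, 0 < rho &
    {in s', forall p, rho <= p /\ {in s', forall q, p != q -> rho <= `|p - q|}}.
  have [|rho rho0 H] := @seq_pos_lower_bound (s' ++ [seq `|p.1 - p.2| | p <- [seq (p, q) | p <- s', q <- s'] & p.1 != p.2]).
    move=> r; rewrite mem_cat => /orP[|/mapP[p]]; first by rewrite mem_undup; exact: s0.
    by rewrite mem_filter => /andP[pq _] ->; rewrite normr_gt0 subr_eq0.
  exists rho => // p ps; split; first by apply: H; rewrite mem_cat ps.
  move=> q qs pq; apply: H; rewrite mem_cat; apply/orP; right.
  by apply/mapP; exists (p, q) => //; rewrite mem_filter pq allpairs_f.
have z0 : 0 < (size s').+1%:R :> R by [].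
have [M MP] : exists M, forall m, (M <= m)%N -> m.+1%:R^-1 < Num.min delta (k * rho) / (size s').+1%:R.
  by apply: ex_invn_lt; rewrite divr_gt0 // lt_min delta0 mulr_gt0.
exists M => m /MP; rewrite ltr_pdivlMr // lt_min => /andP[md mk].
have m0 : 0 < m.+1%:R :> R by [].
have /choice[a aP] : forall p : R, exists a : nat, 0 <= p ->
    [/\ forall j : nat, (m.+1%:R * p <= j%:R) = (a <= j)%N, m.+1%:R * p <= a%:R & a%:R <= m.+1%:R * p + 1].
  move=> p; have [p0|_] := leP 0 p; last by exists 0%N.
  by have [|a aP] := @nat_ceil (m.+1%:R * p); [rewrite mulr_ge0|exists a].
pose c p : R := (a p)%:R / m.+1%:R - p.
have cP p : 0 <= p -> `|c p| <= m.+1%:R^-1.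
  move=> /aP[_ a1 a2]; rewrite /c ler_norml; apply/andP; split.
    rewrite lerBrDl (le_trans (_ : _ <= p)) ?ler_pdivlMr 1?mulrC //.
    by rewrite gerDl oppr_le0 invr_ge0.
  by rewrite lerBlDr ler_pdivrMr // mulrDl mulVf ?gt_eqF // addrC mulrC.
pose f t := \sum_(p <- s') c p * tent rho p t.
have s'0 p : p \in s' -> 0 <= p by rewrite mem_undup => /s0/ltW.
have f_lip t u : `|f t - f u| <= k * `|t - u|.
  rewrite /f -sumrB; apply: (le_trans (ler_norm_sum _ _ _)).
  apply: (@le_trans _ _ (\sum_(p <- s') m.+1%:R^-1 * (`|t - u| / rho))).
    rewrite !big_seq; apply: ler_sum => p ps; rewrite -mulrBr normrM.
    by apply: ler_pM => //; [exact/cP/s'0|exact: tent_lip].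
  rewrite big_const_seq count_predT iter_addr_0 -[leLHS]mulr_natl.
  rewrite mulrA [leLHS](_ : _ = ((size s')%:R * m.+1%:R^-1 / rho) * `|t - u|); last first.
    by rewrite mulrA [RHS]mulrAC.
  apply: ler_wpM2r => //; rewrite ler_pdivrMr // mulrC (le_trans _ (ltW mk)) //.
  by rewrite ler_pM2l ?invr_gt0 // ler_nat.
have f_small t : `|f t| <= delta.
  rewrite /f; apply: (le_trans (ler_norm_sum _ _ _)).
  apply: (@le_trans _ _ (\sum_(p <- s') m.+1%:R^-1)).
    rewrite !big_seq; apply: ler_sum => p ps; rewrite normrM -[leRHS]mulr1.
    have /andP[h0 h1] := tent_itv p t rho0.
    by apply: ler_pM => //; [exact/cP/s'0|rewrite ger0_norm].
  rewrite big_const_seq count_predT iter_addr_0 -[leLHS]mulr_natr (le_trans _ (ltW md)) //.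
  by rewrite ler_pM2l ?invr_gt0 // ler_nat.
have f0 : f 0 = 0.
  rewrite /f big_seq big1 // => p ps; rewrite tent_out ?mulr0 //.
  by rewrite sub0r normrN ger0_norm ?s'0 //; have [] := rhoP _ ps.
have fp p : p \in s' -> f p = c p.
  move=> ps; rewrite /f (bigD1_seq p) ?undup_uniq //= tent_center mulr1.
  rewrite big_seq_cond big1 ?addr0 // => q /andP[qs qp]; rewrite tent_out ?mulr0 //.
  by have [_] := rhoP _ ps; apply; rewrite // eq_sym.
have [tl ll] := lipschitz_timechange k1 f0 f_lip.
exists (fun t => t + f t); split => //.
  by move=> t; rewrite addrAC subrr add0r.
move=> t p t0 ps.
have p0 : 0 <= p by apply/ltW/s0.
have lp : p + f p = (a p)%:R / m.+1%:R by rewrite fp ?mem_undup // /c addrC subrK.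
have -> : (p <= t) = (p + f p <= t + f t).
  apply/idP/idP; last first.
    by apply: contraTT; rewrite -!ltNge => /(timechange_lt tl t0).
  by rewrite le_eqVlt => /predU1P[->//|/(timechange_lt tl p0)/ltW].
have lt0 := timechange_ge0 tl t0.
rewrite lp /gridfloor ler_pdivlMr // [p * _]mulrC.
have [cE _ _] := aP _ p0.
by rewrite cE truncn_ge_nat ?mulr_ge0 // ler_pdivrMr // mulrC.
Qed.

End approx.

Section approx.
Context {R : realType}.
Implicit Types (x y : skorokhod R) (m n : nat) (t u v e : R) (s : seq R).

(** Step functions with integer codes: the code of a path is countable data. *)
Definition grid_step_fun m (c : seq int) t : R :=
  (nth 0 c (Num.truncn (m.+1%:R * t)))%:~R / m.+1%:R.

Lemma grid_step_cadlag m c : cadlag (grid_step_fun m c).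
Proof.
have m0 : 0 < m.+1%:R :> R by [].
split.
- move=> t t0; have mt0 : 0 <= m.+1%:R * t by rewrite mulr_ge0.
  have /andP[h1 h2] := truncn_itv mt0.
  apply: cvg_near_cst; near=> u.
  have tu : t <= u by near: u; exact: nbhs_right_ge.
  have ub : u < (Num.truncn (m.+1%:R * t)).+1%:R / m.+1%:R.
    by near: u; apply: nbhs_right_lt; rewrite ltr_pdivlMr // mulrC.
  rewrite /grid_step_fun (@truncn_def _ (m.+1%:R * u) (Num.truncn (m.+1%:R * t))) //.
  apply/andP; split; last by rewrite mulrC -ltr_pdivlMr.
  by apply: (le_trans h1); rewrite ler_pM2l.
- move=> t t0; have [|a [aj ta a1]] := @nat_ceil R (m.+1%:R * t).
    by rewrite mulr_ge0 // ltW.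
  case: a aj ta a1 => [|a] aj ta a1.
    by have := lt_le_trans (mulr_gt0 m0 t0) ta; rewrite ltxx.
  have at' : a%:R / m.+1%:R < t.
    by rewrite ltr_pdivrMr // mulrC ltNge aj -ltnNge.
  apply: (is_cvg_near_cst ((nth 0 c a)%:~R / m.+1%:R : R)); near=> u.
  have ut : u < t by near: u; exact: nbhs_left_lt.
  have au : a%:R / m.+1%:R < u by near: u; exact: nbhs_left_gt.
  rewrite /grid_step_fun (@truncn_def _ (m.+1%:R * u) a) //; apply/andP; split.
    by rewrite mulrC -ler_pdivrMr // ltW.
  by apply: lt_le_trans ta; rewrite ltr_pM2l.
- move=> t t0; rewrite /grid_step_fun mulr0 truncn0.
  suff -> : Num.truncn (m.+1%:R * t) = 0%N by [].
  by rewrite truncn_floor leNgt pmulr_rlt0 // t0.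
Unshelve. all: by end_near. Qed.

Definition grid_step m c := Skorokhod (grid_step_cadlag m c).

(** The [(m+1)^2] samples cover the times less than [m+1]; these exhaust the
    half-line while the mesh [1/(m+1)] tends to 0. *)
Definition grid_code m x : seq int :=
  mkseq (fun i => Num.floor (m.+1%:R * x (i%:R / m.+1%:R))) (m.+1 ^ 2).

Lemma grid_step_near m x t : 0 <= t < m.+1%:R ->
  `|grid_step m (grid_code m x) t - x (gridfloor m t)| <= m.+1%:R^-1.
Proof.
move=> /andP[t0 tm]; have m0 : 0 < m.+1%:R :> R by [].
rewrite /= /grid_step_fun nth_mkseq; last first.
  rewrite truncn_lt_nat ?mulr_ge0 //; rewrite -mulnn natrM ltr_pM2l //.
rewrite -/(gridfloor m t); set z := x (gridfloor m t).
have /andP[] := floor_itv (m.+1%:R * z); rewrite intrD => h1 h2.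
rewrite (_ : _ - z = ((Num.floor (m.+1%:R * z))%:~R - m.+1%:R * z) / m.+1%:R); last first.
  by rewrite mulrBl [m.+1%:R * z]mulrC mulfK ?gt_eqF.
rewrite normrM (gtr0_norm (x := m.+1%:R^-1)) ?invr_gt0 // ler_piMl ?invr_ge0 // ler_norml; apply/andP; split; lra.
Qed.

Lemma ex_exp2n_lt (e : R) : 0 < e -> exists n, 2 ^- n < e.
Proof.
move=> /ex_invn_lt[n /(_ _ (leqnn n))] ne; exists n; apply: le_lt_trans ne.
by rewrite lef_pV2 ?posrE ?exprn_gt0 // -natrX ler_nat ltn_expl.
Qed.

(** With the time change [l] of [grid_timechange] for the cut points of
    [cadlag_cells], the times [t] and [gridfloor m (l t)] are in the same cell,
    so the discretized path at [l t] is close to [x t].  The tapers add an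
    error of at most the displacement of [l] times a bound of [x]. *)
Lemma grid_step_cvg x e : 0 < e -> exists M, forall m, (M <= m)%N ->
  skdist (grid_step m (grid_code m x)) x < e.
Proof.
move=> e0; have [n ne] : exists n, 2 ^- n < e / 2 by apply: ex_exp2n_lt; rewrite divr_gt0.
pose eta := e / 8; have eta0 : 0 < eta by rewrite divr_gt0.
(* Times beyond [n + 2], displaced by at most 1, are beyond the tapers. *)
pose T : R := n%:R + 2.
have [s0 s0P] := cadlag_cells x T eta0.
pose s := [seq p <- s0 | 0 < p].
have sP u v : 0 <= u -> 0 <= v <= T -> {in s, forall p, (p <= u) = (p <= v)} -> `|x u - x v| <= eta.
  move=> u0 vT H; apply: s0P => // p ps; have [p0|p0] := ltP 0 p.
    by apply: H; rewrite mem_filter p0.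
  by rewrite !(le_trans p0) //; case/andP: vT.
have [B B0 BP] := cadlag_bounded x T.
(* chosen so that [- ln (1 - k) = eta] *)
pose k := 1 - expR (- eta).
have kP : 0 < k < 1.
  by rewrite /k subr_gt0 expR_lt1 oppr_lt0 eta0 /= gtrBl expR_gt0.
have lnk : - ln (1 - k) = eta by rewrite /k subKr expRK opprK.
pose delta := Num.min 1 (eta / (B + 1)).
have B1 : 0 < B + 1 by rewrite ltr_pwDr.
have delta0 : 0 < delta by rewrite lt_min ltr01 divr_gt0.
have [|M1 M1P] := @grid_timechange R s k delta kP delta0.
  by move=> p; rewrite mem_filter => /andP[].
have [M2 M2P] := ex_invn_lt eta0.
exists (maxn (maxn M1 M2) n.+3) => m; rewrite !geq_max => /andP[/andP[/M1P[l [tl ll ld lg]] /M2P m2] nm].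
have m0 : 0 < m.+1%:R :> R by [].
apply: (@le_lt_trans _ _ (4 * eta + 2 ^- n)); last by move: ne; rewrite /eta; lra.
apply: skdist_le => [|N Nn]; first by rewrite mulr_ge0 // ltW.
apply: (@le_trans _ _ (logslope l + tapered_gap N (grid_step m (grid_code m x)) x l)%E).
  by apply: ereal_inf_lbound; exists l.
apply: (@le_trans _ _ (eta%:E + (3 * eta)%:E)%E); last by rewrite -EFinD lee_fin; lra.
apply: leeD; first by rewrite -lnk.
apply: ge_ereal_sup => _ [t + <-]; rewrite [X in X -> _]/= in_itv /= andbT => t0.
rewrite lee_fin.
have lt0 := timechange_ge0 tl t0.
have Nn' : N%:R <= n%:R :> R by rewrite ler_nat.
have := ld t; rewrite le_min => /andP[ld1 ldB].
move: (ld1); rewrite ler_norml => /andP[ld1' ld1''].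
have [tT|Tt] := leP t T; last first.
  rewrite !taper_eq0 ?mul0r ?subrr ?normr0; last 2 first.
    by move: Tt; rewrite /T; lra.
    by move: Tt; rewrite /T; lra.
  by rewrite mulr_ge0 // ltW.
have nm' : n%:R + 3 < m.+1%:R :> R by rewrite -(natrD _ n 3) addn3 ltr_nat.
have A1 : `|grid_step m (grid_code m x) (l t) - x (gridfloor m (l t))| <= eta.
  apply: le_trans (ltW m2); apply: grid_step_near; rewrite lt0 /=.
  by move: tT; rewrite /T; lra.
have A2 : `|x (gridfloor m (l t)) - x t| <= eta.
  apply: sP; rewrite ?t0 //; first by rewrite divr_ge0.
  by move=> p ps; rewrite lg.
have A3 : `|grid_step m (grid_code m x) (l t) - x t| <= 2 * eta.
  by apply: le_trans (ler_distD (x (gridfloor m (l t))) _ _) _; move: A1 A2; lra.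
set G := (grid_step _ _ : skorokhod R) (l t) in A3 *.
rewrite (_ : _ - _ = taper N (l t) * (G - x t) + (taper N (l t) - taper N t) * x t); last first.
  by rewrite mulrBr mulrBl addrA subrK.
apply: (le_trans (ler_normD _ _)); rewrite !normrM.
have C1 : `|taper N (l t)| * `|G - x t| <= 1 * (2 * eta).
  by apply: ler_pM => //; rewrite ger0_norm ?taper_ge0 ?taper_le1.
have C2 : `|taper N (l t) - taper N t| * `|x t| <= eta / (B + 1) * B.
  apply: ler_pM => //; last by apply: BP; rewrite t0.
  exact: le_trans (taper_lip _ _ _) _.
have C3 : eta / (B + 1) * B <= eta.
  by rewrite mulrAC ler_pdivrMr // ler_pM2l // lerDl.
by move: C1 C2 C3; lra.
Qed.

End approx.

Lemma skorokhod_separable (R : realType) : exists q : nat -> skorokhod R,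
  forall x (e : R), 0 < e -> exists i, skdist x (q i) < e.
Proof.
(* Integers which are not codes are sent to an arbitrary path. *)
exists (fun i => if unpickle i is Some (m, c) then @grid_step R m c else @grid_step R 0 [::]).
move=> x e /(grid_step_cvg x)[M /(_ _ (leqnn M)) MP].
by exists (pickle (M, grid_code M x)); rewrite pickleK skdist_sym.
Qed.

(** * Measurability of Skorokhod-open sets *)

Section measurability.
Context {R : realType} (d : measure_display) (T : measurableType d) (f : T -> skorokhod R).
Hypothesis mf : forall t : R, 0 <= t -> measurable_fun setT (fun w => f w t).

Let m_preimage (t : R) (A : set R) : 0 <= t -> measurable A -> measurable [set w | A (f w t)].
Proof. by move=> t0 mA; rewrite -[X in measurable X]setTI; exact: mf. Qed.

Lemma measurable_grid_code m c : measurable [set w | grid_code m (f w) = c].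
Proof.
have [sc|sc] := eqVneq (size c) (m.+1 ^ 2)%N; last first.
  rewrite [X in measurable X](_ : _ = set0) //; apply/seteqP; split=> // w /= wc.
  by move: sc; rewrite -wc size_mkseq eqxx.
have m0 : 0 < m.+1%:R :> R by [].
pose A i : set R := `[(nth 0 c i)%:~R / m.+1%:R, (nth 0 c i + 1)%:~R / m.+1%:R[%classic.
have AE i (y : R) : A i y <-> Num.floor (m.+1%:R * y) = nth 0 c i.
  rewrite /A /= in_itv /= ler_pdivrMr // ltr_pdivlMr // mulrC -floor_eq.
  by split => /eqP.
rewrite [X in measurable X](_ : _ =
  \bigcap_(i in `I_(m.+1 ^ 2)) [set w | A i (f w (i%:R / m.+1%:R))]).
  by apply: bigcap_measurableType => i _; apply: m_preimage; [exact: divr_ge0|exact: measurable_itv].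
apply/seteqP; split=> w /=.
  by move=> wc i /= im; apply/AE; rewrite -wc nth_mkseq.
move=> H; apply: (@eq_from_nth _ 0); first by rewrite size_mkseq.
by move=> i; rewrite size_mkseq => im; rewrite nth_mkseq //; exact/AE/H.
Qed.

(** The discretizations of [f w] take countably many values and converge to
    [f w]; hence [f w] is in [G] if and only if, for some radius, they eventually
    remain in the set of points whose ball of that radius lies in [G]. *)
Lemma measurable_skorokhod_open (G : set (skorokhod R)) : open G -> measurable (f @^-1` G).
Proof.
move=> oG.
have mA m (S : set (skorokhod R)) : measurable [set w | S (grid_step m (grid_code m (f w)))].
  rewrite [X in measurable X](_ : _ = \bigcup_(c : seq int)
    (if `[< S (grid_step m c) >] then [set w | grid_code m (f w) = c] else set0)).
    apply: countable_bigcupT_measurable; first exact: countableP.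
    by move=> c; case: ifP => // _; exact: measurable_grid_code.
  apply/seteqP; split=> w /=.
    by move=> Sw; exists (grid_code m (f w)) => //; rewrite asboolT.
  by move=> [c _]; case: asboolP => //= Sc wc; rewrite wc.
pose Gk k : set (skorokhod R) := [set y | ball y (k.+1%:R^-1) `<=` G].
rewrite [X in measurable X](_ : _ = \bigcup_k \bigcup_M \bigcap_(m in [set m | (M <= m)%N])
  [set w | Gk k (grid_step m (grid_code m (f w)))]).
  by apply: bigcupT_measurable => k; apply: bigcupT_measurable => M; apply: bigcap_measurableType => m _.
apply/seteqP; split=> w /=.
  move=> Gw; have /nbhs_ballP[e /= e0 eG] : nbhs (f w) G by exact: open_nbhs_nbhs.
  have [k /(_ _ (leqnn k)) ke] : exists k, forall m, (k <= m)%N -> m.+1%:R^-1 < e / 2.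
    by apply: ex_invn_lt; rewrite divr_gt0.
  have [M MP] := @grid_step_cvg _ (f w) (e / 2) (divr_gt0 e0 (ltr0Sn _ _)).
  exists k => //; exists M => // m /MP gm y /=; rewrite skballE /= => gy.
  apply: eG; rewrite skballE /=.
  by rewrite skdist_sym in gm; exact: (skdist_lt_split gm (lt_trans gy ke)).
move=> [k _ [M _ H]].
have [M' M'P] := @grid_step_cvg _ (f w) k.+1%:R^-1 (eqbRL (invr_gt0 _) (ltr0Sn _ _)).
apply: (H (maxn M M') (leq_maxl _ _)).
by rewrite skballE /=; apply: M'P; exact: leq_maxr.
Qed.

(** By right continuity it suffices to test the endpoint [S] and the rational
    times. *)
Lemma measurable_sup_dist_le (S : R) (phi : skorokhod R) (delta : R) : 0 <= S ->
  measurable [set w | forall t, 0 <= t <= S -> `|f w t - phi t| <= delta].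
Proof.
move=> S0.
pose A t := [set w | `|f w t - phi t| <= delta].
have mA t : 0 <= t -> measurable (A t).
  move=> t0; rewrite [X in measurable X](_ : _ =
    [set w | `[phi t - delta, phi t + delta]%classic (f w t)]).
    exact: m_preimage.
  by apply/seteqP; split=> w; rewrite /A /= in_itv /= ler_distl.
pose Q := \bigcup_(q : rat) (if (0 <= ratr q :> R) && (ratr q <= S) then ~` A (ratr q) else set0).
rewrite [X in measurable X](_ : _ = A S `\` Q).
  apply: measurableD; first exact: mA.
  apply: bigcupT_measurable_rat => q; case: ifPn => // /andP[q0 _].
  by apply: measurableC; exact: mA.
apply/seteqP; split=> w /=.
  move=> H; split; first by apply: H; rewrite S0 lexx.
  by move=> [q _]; case: ifPn => // qS; apply; exact: H.
move=> [HS HQ] t /andP[t0]; rewrite le_eqVlt => /predU1P[->//|tS].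
rewrite leNgt; apply/negP => dt.
have e0 : 0 < (`|f w t - phi t| - delta) / 3 by rewrite divr_gt0 // subr_gt0.
have [d1 d10 H1] := cadlag_right_osc (f w) t0 e0.
have [d2 d20 H2] := cadlag_right_osc phi t0 e0.
have : t < Num.min S (Num.min (t + d1) (t + d2)) by rewrite !lt_min tS !ltrDl d10.
move=> /rat_in_itvoo[q]; rewrite in_itv /= !lt_min => /andP[tq /andP[qS /andP[qd1 qd2]]].
apply: HQ; exists q => //.
rewrite (le_trans t0 (ltW tq)) (ltW qS) /=; apply/negP; rewrite -ltNge.
have h1 : `|f w t - f w (ratr q)| <= (`|f w t - phi t| - delta) / 3.
  by apply: H1; apply/andP; split; rewrite ?lexx ?ltrDl // ltW.
have h2 : `|phi (ratr q) - phi t| <= (`|f w t - phi t| - delta) / 3.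
  by apply: H2; apply/andP; split; rewrite ?lexx ?ltrDl // ltW.
have h3 := ler_distD (f w (ratr q)) (f w t) (phi t).
have h4 := ler_distD (phi (ratr q)) (f w (ratr q)) (phi t).
by move: dt h1 h2 h3 h4; lra.
Qed.

End measurability.

(** * Logarithmic probabilities *)

Section log_prob.
Context {R : realType} (d : nat -> measure_display)
  (Omega : forall n, measurableType (d n))
  (P : forall n, probability (Omega n) R).
Implicit Types (n : nat).
Local Open Scope ereal_scope.

Lemma le_log_prob n (A B : set (Omega n)) : measurable A -> measurable B ->
  A `<=` B -> log_prob P A <= log_prob P B.
Proof.
move=> mA mB AB; rewrite /log_prob lee_wpmul2l ?lee_fin ?invr_ge0 //.
rewrite lee_lne ?in_itv /= ?leey ?measure_ge0 //.
by apply: le_measure; rewrite ?inE.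
Qed.

Lemma log_prob0 n : (0 < n)%N -> log_prob P (set0 : set (Omega n)) = -oo.
Proof.
move=> n0; rewrite /log_prob measure0 le0_lneNy //.
by rewrite gt0_muleNy // lte_fin invr_gt0 ltr0n.
Qed.

Lemma log_prob_le0 n (A : set (Omega n)) : measurable A -> log_prob P A <= 0.
Proof.
by move=> mA; rewrite /log_prob mule_ge0_le0 ?lee_fin ?invr_ge0 // lne_le0 probability_le1.
Qed.

(** A factor 2 disappears on the scale [1/n]. *)
Lemma log_prob_double n (A B : set (Omega n)) : (0 < n)%N ->
  measurable A -> P n B <= 2%:E * P n A ->
  log_prob P B <= (n%:R^-1 * ln 2)%:E + log_prob P A.
Proof.
move=> n0 mA BA; rewrite /log_prob EFinM.
apply: (@le_trans _ _ (n%:R^-1%:E * lne (2%:E * P n A))).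
  rewrite lee_wpmul2l ?lee_fin ?invr_ge0 // lee_lne //.
    by rewrite in_itv /= measure_ge0 leey.
  by rewrite in_itv /= leey mule_ge0.
have [r r0 ->] : exists2 r, (0 <= r)%R & P n A = r%:E.
  exists (fine (P n A)); first by rewrite fine_ge0.
  by rewrite fineK // fin_num_measure.
move: r0; rewrite le_eqVlt => /predU1P[<-|r0].
  by rewrite mule0 le0_lneNy // gt0_muleNy ?leNye // lte_fin invr_gt0 ltr0n.
rewrite -EFinM !lne_EFin ?mulr_gt0 // -!EFinM -EFinD lee_fin.
by rewrite lnM ?posrE // mulrDr.
Qed.

End log_prob.

(** * Exponential tightness and subsequences obeying a large deviation principle *)

Section puhalskii.
Context {R : realType} (d : nat -> measure_display)
  (Omega : forall n, measurableType (d n))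
  (P : forall n, probability (Omega n) R)
  (X : forall n, Omega n -> skorokhod R).
Hypothesis mX : forall n (G : set (skorokhod R)), open G ->
  measurable (@X n @^-1` G).
Implicit Types (s : nat -> nat) (A B F G K V : set (skorokhod R)) (x : skorokhod R).
Local Open Scope ereal_scope.

Definition upper_rate s A := limn_esup (fun k => log_prob P (@X (s k) @^-1` A)).
Definition lower_rate s A := limn_einf (fun k => log_prob P (@X (s k) @^-1` A)).

Lemma measurable_preimage_closed n F : closed F -> measurable (@X n @^-1` F).
Proof.
by move=> /closed_openC/(mX n)/measurableC; rewrite preimage_setC setCK.
Qed.

Lemma le_upper_rate s A B : (forall n, measurable (@X n @^-1` A)) ->
  (forall n, measurable (@X n @^-1` B)) -> A `<=` B ->
  upper_rate s A <= upper_rate s B.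
Proof.
move=> mA mB AB; apply: le_limn_esup; apply: nearW => k.
by apply: le_log_prob => // w; exact: AB.
Qed.

Lemma le_lower_rate s A B : (forall n, measurable (@X n @^-1` A)) ->
  (forall n, measurable (@X n @^-1` B)) -> A `<=` B ->
  lower_rate s A <= lower_rate s B.
Proof.
move=> mA mB AB; apply: le_limn_einf; apply: nearW => k.
by apply: le_log_prob => // w; exact: AB.
Qed.

Variable s : nat -> nat.
Hypothesis s_homo : {homo s : m n / (m < n)%N}.

(** The principle of the largest term. *)
Lemma upper_rateU (c : R) A B : (forall n, measurable (@X n @^-1` A)) ->
  (forall n, measurable (@X n @^-1` B)) ->
  upper_rate s A <= c%:E -> upper_rate s B <= c%:E ->
  upper_rate s (A `|` B) <= c%:E.
Proof.
move=> mA mB Ac Bc; apply/lee_addgt0Pr => e e0.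
have e20 : (0 < e / 2)%R by rewrite divr_gt0.
apply: near_le_limn_esup.
have lt_add (x : \bar R) : x <= c%:E -> x < c%:E + (e / 2)%:E.
  by move=> /le_lt_trans; apply; rewrite -EFinD lte_fin ltrDl.
have nA := limn_esup_lt_near (lt_add _ Ac).
have nB := limn_esup_lt_near (lt_add _ Bc).
have ns : \forall k \near \oo, ((s k)%:R^-1 * ln 2 <= e / 2 :> R)%R.
  apply: (near_subseq (A := fun n => (n%:R^-1 * ln 2 <= e / 2 :> R)%R) s_homo).
    exists (Num.truncn ((ln 2 : R) / (e / 2))%R).+1 => // n /= nN.
    have n0 : (0 < n%:R :> R)%R by rewrite ltr0n; apply: leq_trans nN.
    rewrite mulrC ler_pdivrMr // mulrC -ler_pdivrMr //.
    by rewrite ltW // (lt_le_trans (truncnS_gt _)) // ler_nat.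
have n1 : \forall k \near \oo, (0 < s k)%N.
  by apply: (near_subseq (A := fun n => (0 < n)%N) s_homo); exists 1%N.
near=> k.
have k0 : (0 < s k)%N by near: k.
have Ak : log_prob P (@X (s k) @^-1` A) < c%:E + (e / 2)%:E by near: k.
have Bk : log_prob P (@X (s k) @^-1` B) < c%:E + (e / 2)%:E by near: k.
have ek : ((s k)%:R^-1 * ln 2 <= e / 2 :> R)%R by near: k.
have PU : P (s k) (@X (s k) @^-1` (A `|` B)) <=
    P (s k) (@X (s k) @^-1` A) + P (s k) (@X (s k) @^-1` B).
  by rewrite preimage_setU measureU2.
have twoE (x : \bar R) : x + x = 2%:E * x by rewrite mule_natl.
have key C : (forall n, measurable (@X n @^-1` C)) ->
    log_prob P (@X (s k) @^-1` C) < c%:E + (e / 2)%:E ->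
    P (s k) (@X (s k) @^-1` (A `|` B)) <= 2%:E * P (s k) (@X (s k) @^-1` C) ->
    log_prob P (@X (s k) @^-1` (A `|` B)) <= c%:E + e%:E.
  move=> mC Ck /(log_prob_double k0 (mC _))/le_trans; apply.
  have -> : c%:E + e%:E = (e / 2)%:E + (c%:E + (e / 2)%:E).
    by rewrite -!EFinD; congr EFin; lra.
  by rewrite leeD ?lee_fin // ltW.
have [AB|BA] := leP (P (s k) (@X (s k) @^-1` A)) (P (s k) (@X (s k) @^-1` B)).
  by apply: (key B) => //; apply: (le_trans PU); rewrite -twoE leeD2r.
by apply: (key A) => //; apply: (le_trans PU); rewrite -twoE leeD2l // ltW.
Unshelve. all: by end_near. Qed.

Lemma upper_rate0 : upper_rate s set0 = -oo.
Proof.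
apply/eqP; rewrite -leeNy_eq; apply: near_le_limn_esup.
have : \forall k \near \oo, (0 < s k)%N
  by apply: (near_subseq (A := fun n => (0 < n)%N) s_homo); exists 1%N.
by apply: filterS => k k0; rewrite preimage_set0 log_prob0.
Qed.

(** The exponential rate of decay of the probability of small balls around
    [x]. *)
Definition local_rate x := ereal_sup [set - lower_rate s (ball x e) | e in [set e : R | (0 < e)%R]].

Hypothesis Xtight : exponentially_tight P X.
Hypothesis s_reg : forall x (e : R), (0 < e)%R ->
  exists2 e' : R, (0 < e')%R & upper_rate s (ball x e') <= lower_rate s (ball x e).

Let local_rate_lb G x : open G -> G x -> - local_rate x <= lower_rate s G.
Proof.
move=> oG Gx; have /nbhs_ballP[e /= e0 eG] : nbhs x G by exact: open_nbhs_nbhs.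
rewrite leeNl; apply: (@le_trans _ _ (- lower_rate s (ball x e))).
  rewrite leeN2; apply: le_lower_rate => // n; apply: mX => //.
  exact: skball_open.
by apply: ereal_sup_ubound; exists e.
Qed.

(** The regularity hypothesis [s_reg] says that the upper and lower local rates
    agree.  The lower bound only uses the lower rates, by definition of
    [local_rate]; the upper bound uses that a point with [c < local_rate x] is the
    centre of a ball whose upper rate is at most [- c]. *)
Lemma local_rate_ldp : ldp P X s local_rate.
Proof.
have mB n x e : measurable (@X n @^-1` ball x e) by apply: mX; exact: skball_open.
have tight_sub K c : limn_esup (fun n => log_prob P (@X n @^-1` (~` K))) <= c ->
    upper_rate s (~` K) <= c.
  exact/le_trans/(limn_esup_sub (fun n => log_prob P (@X n @^-1` (~` K)))).
have lsc (a : R) : closed [set x | local_rate x <= a%:E].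
  rewrite -[X in closed X]setCK; apply: open_closedC; rewrite openE => x /= /negP.
  rewrite -ltNge => /ereal_sup_gt[_ [e /= e0 <-] ax].
  apply/nbhs_ballP; exists e => //= y xy; apply/negP; rewrite -ltNge.
  apply: (lt_le_trans ax); rewrite leeNl; apply: local_rate_lb => //.
  exact: skball_open.
split.
- move=> x; apply: (@le_trans _ _ (- lower_rate s (ball x 1))); last first.
    by apply: ereal_sup_ubound; exists 1%R => //=.
  rewrite leeNr oppe0; apply: le_trans (limn_einf_sup _) _.
  by apply: near_le_limn_esup; apply: nearW => k; exact: log_prob_le0.
- move=> a a0; have [K cK Ka] := Xtight (ltr_pwDr ltr01 a0).
  apply: (subclosed_compact _ cK); first exact: lsc.
  move=> x /= xa; apply: contrapT => nKx.
  have := local_rate_lb (closed_openC (skcompact_closed cK)) nKx.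
  move=> /le_trans/(_ (limn_einf_sup _))/le_trans/(_ (tight_sub _ _ Ka)).
  rewrite EFinN leeN2 => /le_trans/(_ xa); rewrite lee_fin; lra.
- move=> G oG; rewrite leeNl; apply: le_ereal_inf_tmp => _ [x Gx <-].
  by rewrite leeNl; exact: local_rate_lb.
move=> F cF; rewrite -/(upper_rate s F) leNgt; apply/negP => /lte_between_fin[b /andP[]].
rewrite lteNl => bI; apply/negP; rewrite -leNgt.
have [K cK Kb] : exists2 K, compact K & upper_rate s (~` K) <= b%:E.
  have c0 : (0 < Num.max 1 (- b))%R by rewrite lt_max ltr01.
  have [K cK Kb] := Xtight c0; exists K => //; apply: tight_sub; apply: (le_trans Kb).
  by rewrite lee_fin lerNl le_max lexx orbT.
have [V [oV KV Vb]] : exists V, [/\ open V, K `&` F `<=` V & upper_rate s V <= b%:E].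
  apply: (@compact_ind _ (K `&` F) (fun A => exists V, [/\ open V, A `<=` V & upper_rate s V <= b%:E])).
  - exact: compact_closedI.
  - by exists set0; split; [exact: open0|by []|rewrite upper_rate0 leNye].
  - by move=> A B AB [V [oV BV Vb]]; exists V; split => //; exact: subset_trans BV.
  - move=> A B [V [oV AV Vb]] [W [oW BW Wb]]; exists (V `|` W); split.
    + exact: openU.
    + exact: setUSS.
    + by apply: upper_rateU => // n; exact: mX.
  - move=> x [Kx Fx]; have : - b%:E < local_rate x.
      by apply: (lt_le_trans bI); apply: ereal_inf_lbound; exists x.
    move=> /ereal_sup_gt[_ [e e0 <-]]; rewrite lteN2 => eb.
    have [e' e'0 ee'] := s_reg x e0.
    exists (ball x e'); first exact: nbhsx_ballx.
    exists (ball x e'); split => //; first exact: skball_open.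
    exact: le_trans ee' (ltW eb).
have mK n : measurable (@X n @^-1` (~` K)).
  by apply: mX; apply: closed_openC; exact: skcompact_closed.
apply: (@le_trans _ _ (upper_rate s (V `|` ~` K))).
  apply: le_upper_rate => [n|n|x Fx]; first exact: measurable_preimage_closed.
    by rewrite preimage_setU; apply: measurableU => //; exact: mX.
  by have [Kx|nKx] := pselect (K x); [left; exact: KV|right].
by apply: upper_rateU => // n; exact: mX.
Qed.

End puhalskii.

Section puhalskii.
Context {R : realType} (d : nat -> measure_display)
  (Omega : forall n, measurableType (d n))
  (P : forall n, probability (Omega n) R)
  (X : forall n, Omega n -> skorokhod R).
Hypothesis mX : forall n (G : set (skorokhod R)), open G ->
  measurable (@X n @^-1` G).
Implicit Types (s : nat -> nat) (A B F G K V : set (skorokhod R)) (x : skorokhod R).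
Local Open Scope ereal_scope.

(** It suffices to decide, for each ball of the countable base and each rational
    level, on which side of the level its logarithmic probabilities eventually
    are: the ball of radius [e] around [x] contains a ball of the base, which in
    turn contains a smaller ball around [x]. *)
Lemma regular_subseq s (q : nat -> skorokhod R) :
  (forall x (e : R), (0 < e)%R -> exists i, (skdist x (q i) < e)%R) ->
  exists2 t : nat -> nat, {homo t : m n / (m < n)%N} &
    forall x (e : R), (0 < e)%R -> exists2 e' : R, (0 < e')%R &
      upper_rate P X (s \o t) (ball x e') <= lower_rate P X (s \o t) (ball x e).
Proof.
move=> qd.
pose A n : set nat := if unpickle n is Some (i, j, a) then
  [set k | log_prob P (@X (s k) @^-1` ball (q i) j.+1%:R^-1) < (ratr (a : rat))%:E] else set0.
have [t ht At] := deciding_subseq A.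
exists t => // x e e0.
have e20 : (0 < e / 2)%R by rewrite divr_gt0.
have [j je] : exists j, (j.+1%:R^-1 < e / 2)%R.
  exists (Num.truncn (e / 2)^-1); rewrite -[ltRHS]invrK ltf_pV2 ?posrE ?invr_gt0 //.
  exact: truncnS_gt.
have j0 : (0 < j.+1%:R^-1 :> R)%R by rewrite invr_gt0.
have [i xi] := qd x _ j0.
exists (j.+1%:R^-1 - skdist x (q i))%R; first by rewrite subr_gt0.
have mB n y r : measurable (@X n @^-1` ball y r) by apply: mX; exact: skball_open.
apply: (@le_trans _ _ (upper_rate P X (s \o t) (ball (q i) j.+1%:R^-1))).
  apply: le_upper_rate => [n|n|y]; [exact: mB|exact: mB|rewrite !skballE /= => xy].
  have xqy := skdist_triangle x (q i) y; rewrite [skdist (q i) x]skdist_sym in xqy.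
  by rewrite ltrBrDl in xy; exact: (le_lt_trans xqy xy).
apply: (@le_trans _ _ (lower_rate P X (s \o t) (ball (q i) j.+1%:R^-1))); last first.
  apply: le_lower_rate => [n|n|y]; [exact: mB|exact: mB|rewrite !skballE /= => yi].
  by apply: (skdist_lt_split (lt_trans xi je) (lt_trans yi je)).
apply: limn_esup_le_einf => a.
by have := At (pickle (i, j, a)); rewrite /A pickleK.
Qed.

(** Puhalskii's theorem: exponential tightness implies large deviation relative
    compactness. *)
Lemma ldp_subseq s (q : nat -> skorokhod R) : {homo s : m n / (m < n)%N} ->
  (forall x (e : R), (0 < e)%R -> exists i, (skdist x (q i) < e)%R) ->
  exponentially_tight P X ->
  exists2 t : nat -> nat, {homo t : m n / (m < n)%N} & exists I, ldp P X (s \o t) I.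
Proof.
move=> hs qd Xt; have [t ht treg] := regular_subseq s qd.
exists t => //; exists (local_rate P X (s \o t)); apply: local_rate_ldp => //.
by move=> m n mn /=; apply/hs/ht.
Qed.

(** The subsequence principle for large deviations, as for convergence in a
    topological space. *)
Lemma ldp_of_subseq I :
  (forall s, {homo s : m n / (m < n)%N} ->
     exists2 t : nat -> nat, {homo t : m n / (m < n)%N} & ldp P X (s \o t) I) ->
  ldp P X id I.
Proof.
move=> H; have [t _ [I0 Icpt _ _]] := H id (fun _ _ => id).
split => //.
- move=> G oG; rewrite leNgt; apply/negP => /lte_between_fin[b /andP[Gb bG]].
  have [s hs sb] : exists2 s, {homo s : m n / (m < n)%N} &
      forall k, log_prob P (@X (s k) @^-1` G) < b%:E.
    apply: (@frequently_subseq [set n | log_prob P (@X n @^-1` G) < b%:E]).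
    move=> nb; move: Gb; apply/negP; rewrite -leNgt; apply: near_ge_limn_einf.
    by apply: filterS nb => n /= /negP; rewrite -leNgt.
  have [t' ht [_ _ /(_ _ oG) + _]] := H _ hs.
  move=> /(lt_le_trans bG)/lt_le_trans/(_ (limn_einf_sup _)); apply/negP; rewrite -leNgt.
  by apply: near_le_limn_esup; apply: nearW => k; exact/ltW/sb.
- move=> F cF; rewrite leNgt; apply/negP => /lte_between_fin[b /andP[Fb bF]].
  have [s hs sb] : exists2 s, {homo s : m n / (m < n)%N} &
      forall k, b%:E < log_prob P (@X (s k) @^-1` F).
    apply: (@frequently_subseq [set n | b%:E < log_prob P (@X n @^-1` F)]).
    move=> nb; move: bF; apply/negP; rewrite -leNgt; apply: near_le_limn_esup.
    by apply: filterS nb => n /= /negP; rewrite -leNgt.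
  have [t' ht [_ _ _ /(_ _ cF)]] := H _ hs.
  move=> /le_lt_trans/(_ Fb); apply/negP; rewrite -leNgt.
  apply: le_trans (limn_einf_sup _).
  by apply: near_ge_limn_einf; apply: nearW => k; exact/ltW/sb.
Qed.

End puhalskii.

(** * Uniform tubes and Skorokhod balls *)

Section tubes.
Context {R : realType}.
Implicit Types (x phi : skorokhod R) (t u e : R).

(** Uniform continuity on compact intervals, with the second time free. *)
Lemma continuous_path_osc phi (M e : R) : continuous_paths phi -> 0 < e ->
  exists2 d : R, 0 < d & forall t u, 0 <= t <= M -> 0 <= u -> `|t - u| < d -> `|phi t - phi u| <= e.
Proof.
move=> cphi e0.
pose Q (A : set R) := exists2 d : R, 0 < d &
  forall t u, A t -> 0 <= t -> 0 <= u -> `|t - u| < d -> `|phi t - phi u| <= e.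
suff [d d0 dP] : Q `[0, M]%classic.
  by exists d => // t u /andP[t0 tM] u0; apply: dP => //=; rewrite in_itv /= t0.
apply: compact_ind; first exact: segment_compact.
- by exists 1.
- by move=> A B AB [b b0 bP]; exists b => // t u /AB; exact: bP.
- move=> A B [a a0 aP] [b b0 bP]; exists (Num.min a b); first by rewrite lt_min a0.
  by move=> t u [At|Bt] t0 u0; rewrite lt_min => /andP[ta tb]; [exact: aP|exact: bP].
move=> t; rewrite /= in_itv /= => /andP[t0 tM].
have e20 : 0 < e / 2 by rewrite divr_gt0.
have [d d0 dP] : exists2 d : R, 0 < d & forall u, 0 <= u -> `|t - u| < d -> `|phi t - phi u| <= e / 2.
  have /subspace_continuousP/(_ t) := cphi.
  rewrite /= in_itv /= t0 => /(_ isT)/cvgrPdist_le/(_ _ e20).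
  by move=> [d /= d0 H]; exists d => // u u0 tu; apply: H => //=; rewrite in_itv /= u0.
exists (ball t (d / 2)); first by apply: nbhsx_ballx; rewrite divr_gt0.
exists (d / 2); first by rewrite divr_gt0.
move=> u v; rewrite /ball /= => tu u0 v0 uv.
have h1 := dP u u0; have h2 := dP v v0.
have h3 := ler_distD u t v.
have h4 := ler_distD (phi t) (phi u) (phi v).
have d1 : `|t - u| < d by move: tu d0; lra.
have d2 : `|t - v| < d by move: h3 tu uv; lra.
by move: h4 (h1 d1) (h2 d2); rewrite [`|phi u - phi t|]distrC; lra.
Qed.

(** A time change with small distortion displaces times in [[0, T]] by little;
    the displacement is absorbed by the uniform continuity of [phi]. *)
Lemma skball_unif_near phi (T e : R) : continuous_paths phi -> 0 < T -> 0 < e ->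
  exists2 eta : R, 0 < eta & forall x, skdist x phi < eta ->
    forall t, 0 <= t <= T -> `|x t - phi t| <= e.
Proof.
move=> cphi T0 e0.
pose N := (Num.truncn (T + 1)).+1.
have TN : T + 1 < N%:R by exact: truncnS_gt.
have e20 : 0 < e / 2 by rewrite divr_gt0.
have [d d0 dP] := continuous_path_osc (T + 1) cphi e20.
(* If [t / s] and [s / t] are less than [1 + k] and [s <= T], then
   [`|t - s| < Num.min 1 d]. *)
pose k := Num.min 1 d / (T + 2).
have k0 : 0 < k by rewrite divr_gt0 ?lt_min ?ltr01 // addr_gt0.
have kT : k * (T + 1) < Num.min 1 d.
  rewrite /k mulrAC ltr_pdivrMr ?addr_gt0 // ltr_pM2l ?lt_min ?ltr01 //; lra.
pose eta := Num.min (Num.min 1 (e / 2)) (ln (1 + k)).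
have eta0 : 0 < eta by rewrite !lt_min ltr01 e20 /= ln_gt0 // ltrDl.
have eta1 : eta <= 1 by rewrite !ge_min lexx.
have etae : eta <= e / 2 by rewrite !ge_min lexx orbT.
have etak : eta <= ln (1 + k) by rewrite !ge_min lexx orbT.
exists (2 ^- N * eta); first by rewrite mulr_gt0 // invr_gt0 exprn_gt0.
move=> x /(skdist_upto_lt (isT : (0 < N)%N) eta1)/ereal_inf_lt[_ [l tl <-] leta] s /andP[s0 sT].
have [g tg gP] := timechange_inv tl.
have [lg _] := gP _ s0; have gs0 := timechange_ge0 tg s0.
set t := g s in lg gs0.
have [tT std] : t <= T + 1 /\ `|t - s| < d.
  have [se|sn0] := eqVneq s 0.
    have -> : t = 0 by rewrite /t se (timechange0 tg).
    by rewrite se subrr normr0; split => //; lra.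
  have sp : 0 < s by rewrite lt0r sn0.
  have tp : 0 < t.
    rewrite lt0r gs0 andbT; apply/eqP => t0; move: lg; rewrite t0 (timechange0 tl).
    by move=> /esym/eqP; rewrite (negbTE sn0).
  have : ((`|ln (s / t)|)%:E < (ln (1 + k))%:E)%E.
    apply: (@lt_le_trans _ _ eta%:E%E); last by rewrite lee_fin.
    apply: le_lt_trans leta; apply: le_trans (leeDl _ (tapered_gap_ge0 _ _ _ _)).
    by have := logslope_ub l (lexx _) tp; rewrite lg (timechange0 tl) !subr0.
  have k1 : 0 < 1 + k by rewrite addr_gt0.
  rewrite lte_fin ltr_norml -lnV ?posrE // !ltr_ln ?posrE ?invr_gt0 ?divr_gt0 //.
  rewrite ltr_pdivlMr // ltr_pdivrMr // mulrC ltr_pdivrMr // => /andP[h1 h2].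
  have tT : t <= T + 1.
    have ks : k * s <= k * (T + 1) by rewrite ler_pM2l //; lra.
    by move: h1 kT; rewrite lt_min => + /andP[kT _]; lra.
  split => //; rewrite ltr_norml; move: kT; rewrite lt_min => /andP[_ kT].
  have ks : k * s <= k * (T + 1) by rewrite ler_pM2l //; lra.
  have kt : k * t <= k * (T + 1) by rewrite ler_pM2l.
  by apply/andP; split; lra.
have gap : `|x s - phi t| <= e / 2.
  rewrite -lee_fin; apply: (@le_trans _ _ eta%:E%E); last by rewrite lee_fin.
  apply: le_trans (ltW leta); apply: le_trans (leeDr _ (logslope_ge0 l)).
  by have := tapered_gap_ub N x phi l gs0; rewrite lg !taper_eq1 ?mul1r //; lra.
have osc : `|phi t - phi s| <= e / 2 by apply: dP => //; rewrite gs0.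
by have := ler_distD (phi t) (x s) (phi s); lra.
Qed.

(** The distances up to level [N <= n] only see times up to [n + 1]; the levels
    beyond [n] contribute at most [2 ^- n]. *)
Lemma unif_near_skball phi e : 0 < e -> exists2 T : R, 0 < T & forall delta x, delta <= e / 2 ->
  (forall t, 0 <= t <= T -> `|x t - phi t| <= delta) -> skdist x phi <= e.
Proof.
move=> e0; have [n ne] : exists n, 2 ^- n < e / 2 by apply: ex_exp2n_lt; rewrite divr_gt0.
exists (n%:R + 1) => [|delta x de xphi]; first by rewrite ltr_pwDr.
apply: (@le_trans _ _ (e / 2 + 2 ^- n)); last by move: ne; lra.
apply: skdist_le => [|N Nn]; first by rewrite divr_ge0 // ltW.
apply: skdist_upto_unif => [|t /andP[t0 tN]]; first by rewrite divr_ge0 // ltW.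
apply: (le_trans _ de); apply: xphi; rewrite t0 (le_trans tN) // lerD2r ler_nat //.
Qed.

Lemma closed_ball_skdist x e : closed [set y | skdist y x <= e].
Proof.
rewrite -[X in closed X]setCK; apply: open_closedC; rewrite openE => y /= /negP.
rewrite -ltNge => xy; apply/nbhs_ballP; exists (skdist y x - e) => /=; first by rewrite subr_gt0.
move=> z; rewrite skballE /= => yz; apply/negP; rewrite -ltNge.
have := skdist_triangle z y x.
by move: (skdist y x) (skdist y z) (skdist z x) xy yz => a b c; lra.
Qed.

End tubes.

(** * Identification of the rate function *)

Section identification.
Context {R : realType} (d : nat -> measure_display)
  (Omega : forall n, measurableType (d n))
  (P : forall n, probability (Omega n) R)
  (X : forall n, Omega n -> skorokhod R).
Hypothesis mX : forall n (t : R), 0 <= t -> measurable_fun setT (fun w => @X n w t).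
Implicit Types (s : nat -> nat) (phi x : skorokhod R) (T delta : R).

Definition tube phi T delta : set (skorokhod R) :=
  [set x : skorokhod R | forall t, 0 <= t <= T -> `|x t - phi t| <= delta].

Lemma unif_tubeE n T phi delta : @unif_tube _ _ _ X n T phi delta = @X n @^-1` tube phi T delta.
Proof.
apply/seteqP; split=> w; rewrite /unif_tube /tube /=.
  move=> H t tT; rewrite -lee_fin; apply: le_trans H.
  by apply: ereal_sup_ubound; exists t => //=; rewrite in_itv.
by move=> H; apply: ge_ereal_sup => _ [t + <-]; rewrite /= in_itv /= lee_fin; exact: H.
Qed.

Lemma measurable_tube n phi T delta : 0 < T -> measurable (@X n @^-1` tube phi T delta).
Proof. by move=> T0; apply: measurable_sup_dist_le; [exact: mX|exact: ltW]. Qed.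

Let mXo n (G : set (skorokhod R)) : open G -> measurable (@X n @^-1` G).
Proof. by apply: measurable_skorokhod_open => t; exact: mX. Qed.

Variables (s : nat -> nat) (I : skorokhod R -> \bar R).
Hypothesis s_homo : {homo s : m n / (m < n)%N}.
Hypothesis XI : ldp P X s I.
Local Open Scope ereal_scope.

(** The tube contains a Skorokhod ball around [phi]; the lower bound applies to
    that ball. *)
Lemma ldp_tube_ge phi T delta : continuous_paths phi -> (0 < T)%R -> (0 < delta)%R ->
  - I phi <= limn_esup (fun n => log_prob P (@unif_tube _ _ _ X n T phi delta)).
Proof.
move=> cphi T0 delta0; have [eta eta0 etaP] := skball_unif_near cphi T0 delta0.
have [_ _ lower _] := XI.
have oB := @skball_open _ phi eta.
apply: (@le_trans _ _ (- ereal_inf (I @` ball phi eta))).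
  by rewrite leeN2; apply: ereal_inf_lbound; exists phi => //; exact: ballxx.
apply: (le_trans (lower _ oB)); apply: (le_trans (limn_einf_sup _)).
apply: le_trans (limn_esup_sub (fun n => log_prob P (@unif_tube _ _ _ X n T phi delta)) s_homo).
apply: le_limn_esup; apply: nearW => k /=; rewrite unif_tubeE.
apply: le_log_prob; [exact: mXo|exact: measurable_tube|].
by move=> w /=; rewrite skballE /= skdist_sym; exact: etaP.
Qed.

(** The level set of [I] at [b] is closed and avoids [phi], hence avoids a closed
    ball around [phi]; that ball contains a tube and has rate at least [b]. *)
Lemma ldp_tube_le phi (b : R) : (0 <= b)%R -> b%:E < I phi ->
  exists2 T : R, (0 < T)%R & exists2 e : R, (0 < e)%R & forall delta, (delta <= e)%R ->
    limn_einf (fun n => log_prob P (@unif_tube _ _ _ X n T phi delta)) <= - b%:E.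
Proof.
move=> b0 bI; have [_ cpt _ upper] := XI.
have oI : open (~` [set x | I x <= b%:E]).
  by apply: closed_openC; apply: skcompact_closed; exact: cpt.
have /nbhs_ballP[e /= e0 eI] : nbhs phi (~` [set x | I x <= b%:E]).
  by apply: open_nbhs_nbhs; split => //=; apply/negP; rewrite -ltNge.
have e20 : (0 < e / 2)%R by rewrite divr_gt0.
have [T T0 TP] := unif_near_skball phi e20.
exists T => //; exists (e / 2 / 2)%R; first by rewrite divr_gt0.
move=> delta de.
set F := [set y | (skdist y phi <= e / 2)%R].
have cF : closed F by apply: closed_ball_skdist.
have FI : b%:E <= ereal_inf (I @` F).
  apply: le_ereal_inf_tmp => _ [y Fy <-].
  have /eI /= : ball phi e y.
    by rewrite skballE /= skdist_sym; apply: (le_lt_trans Fy); rewrite ltr_pdivrMr // ltr_pMr // ltr1n.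
  by move=> /negP; rewrite -ltNge => /ltW.
apply: (@le_trans _ _ (- ereal_inf (I @` F))); last by rewrite EFinN leeN2.
apply: le_trans (upper _ cF).
apply: (le_trans (limn_einf_sub (fun n => log_prob P (@unif_tube _ _ _ X n T phi delta)) s_homo)).
apply: (le_trans (limn_einf_sup _)).
apply: le_limn_esup; apply: nearW => k /=; rewrite unif_tubeE.
apply: le_log_prob; [exact: measurable_tube|exact: measurable_preimage_closed|].
by move=> w /=; exact: TP.
Qed.

End identification.

Theorem theorem1p3 (R : realType) (d : nat -> measure_display)
  (Omega : forall n, measurableType (d n))
  (P : forall n, probability (Omega n) R)
  (X : forall n, Omega n -> skorokhod R)
  (mX : forall n (t : R), 0 <= t -> measurable_fun setT (fun w => X n w t))
  (ctight : C_exponentially_tight P X)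
  (J : R -> skorokhod R -> \bar R)
  (J_ge0 : forall (T : R) (phi : skorokhod R), 0 < T -> continuous_paths phi ->
    (0 <= J T phi)%E)
  (J_liminf : forall (T : R) (phi : skorokhod R), 0 < T -> continuous_paths phi ->
    limn_einf (fun n => log_prob P (@unif_tube _ _ _ X n T phi delta))
      @[delta --> 0^'+] --> (- J T phi)%E)
  (J_limsup : forall (T : R) (phi : skorokhod R), 0 < T -> continuous_paths phi ->
    limn_esup (fun n => log_prob P (@unif_tube _ _ _ X n T phi delta))
      @[delta --> 0^'+] --> (- J T phi)%E) :
  ldp P X id (fun phi =>
    if phi \in @continuous_paths R
    then ereal_sup [set J T phi | T in [set T : R | 0 < T]]
    else +oo%E).
Proof.
have [tight offC] := ctight.
have mXo n (G : set (skorokhod R)) : open G -> measurable (@X n @^-1` G).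
  by apply: measurable_skorokhod_open => t; exact: mX.
have [q qP] := skorokhod_separable R.
apply: ldp_of_subseq => // s s_homo.
have [t t_homo [I XI]] := ldp_subseq mXo s_homo qP tight.
have st_homo : {homo s \o t : m n / (m < n)%N} by move=> m n mn /=; apply/s_homo/t_homo.
exists t => //.
rewrite (_ : (fun phi => _) = I) //; apply/funext => phi.
have [/set_mem cphi|/negP nphi] := boolP (phi \in _); last first.
  by rewrite (offC _ _ st_homo XI) // => ?; apply: nphi; exact: mem_set.
apply/eqP; rewrite eq_le; apply/andP; split.
  apply: ge_ereal_sup => _ [T /= T0 <-]; rewrite -leeN2.
  have Jlim := J_limsup T phi T0 cphi.
  rewrite -(cvg_lim _ Jlim) //; apply: lime_ge; first by apply/cvg_ex; eexists; exact: Jlim.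
  near=> delta; apply: (ldp_tube_ge mX st_homo XI cphi T0).
  by near: delta; exact: nbhs_right_gt.
rewrite leNgt; apply/negP => /lte_between_fin[b /andP[Jb bI]].
have b0 : 0 <= b.
  rewrite -lee_fin; apply: le_trans (ltW Jb); apply: (le_trans (J_ge0 1 phi ltr01 cphi)).
  by apply: ereal_sup_ubound; exists 1 => /=.
have [T T0 [e e0 eP]] := ldp_tube_le mX st_homo XI b0 bI.
have Jlim := J_liminf T phi T0 cphi.
have : (- J T phi <= - b%:E)%E.
  rewrite -(cvg_lim _ Jlim) //; apply: lime_le; first by apply/cvg_ex; eexists; exact: Jlim.
  near=> delta; apply: eP.
  by near: delta; exact: nbhs_right_ltW.
rewrite leeN2 leNgt => /negP; apply; apply: le_lt_trans Jb.
by apply: ereal_sup_ubound; exists T.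
Unshelve. all: by end_near. Qed.
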